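(* Let $k\ge3$ and let $(q_m)_{m\ge1}$ be an increasing sequence of prime powers, $q_m=p_m^{e_m}$ with $p_m$ prime. For each $m$ let $f_{i,m},g_{i,m}\in\mathbb{F}_{q_m}[X]$ ($3\le i\le k$) be polynomials of degree at most $q_m-1$ with $g_{i,m}(-X)=-g_{i,m}(X)$ and $g_{i,m}(0)=0$, and consider $S(k,q_m)=S(k,q_m;f_{3,m},g_{3,m},\ldots,f_{k,m},g_{k,m})$. Set $d_f^{(m)}=\max_{3\le i\le k}\deg f_{i,m}$ and $d_g^{(m)}=\max_{3\le i\le k}\deg g_{i,m}$. Suppose $1\le d_f^{(m)}=o_m(q_m)$, $d_g^{(m)}=o_m(\sqrt{q_m})$, $1\le d_g^{(m)}<p_m$, and for every $m\ge1$ at least one of the following holds: (1) the polynomials $1,X,f_{3,m},\ldots,f_{k,m}$ are $\mathbb{F}_{q_m}$-linearly independent and every $g_{i,m}$, $3\le i\le k$, has a nonzero coefficient of $X$; (2) the polynomials $f_{3,m},\ldots,f_{k,m}$ are $\mathbb{F}_{q_m}$-linearly independent and there is some $j$ with $2\le j\le d_g^{(m)}$ such that for every $i$, $3\le i\le k$, the coefficient of $X^j$ in $g_{i,m}$ is nonzero. Then each $S(k,q_m)$ is connected and $\lambda_2(S(k,q_m))=o_m(q_m^2)$.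
   Context: For a prime power $q$, integer $k\ge3$, and polynomials $f_i,g_i\in\mathbb{F}_q[X]$ ($3\le i\le k$) of degree at most $q-1$ with $g_i(-X)=-g_i(X)$, the graph $S(k,q;f_3,g_3,\ldots,f_k,g_k)$ is the simple graph with vertex set $\mathbb{F}_q^k$ in which $a=(a_1,\ldots,a_k)$ and $b=(b_1,\ldots,b_k)$ are adjacent iff $a_1\ne b_1$ and $b_i-a_i=g_i(b_1-a_1)\,f_i\!\left(\frac{b_2-a_2}{b_1-a_1}\right)$ for all $3\le i\le k$. It is $q(q-1)$-regular. $\lambda_2$ denotes the second largest eigenvalue of the adjacency matrix (eigenvalues listed with multiplicity). For functions $f,g:\mathbb{N}\to\mathbb{R}^+$, $f=o_m(g)$ means $f(m)/g(m)\to0$ as $m\to\infty$. *)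

(* Defs.v *)
From HB Require Import structures.
From mathcomp Require Import all_boot all_order all_algebra all_field.
Set Implicit Arguments. Unset Strict Implicit. Unset Printing Implicit Defensive.
Import Order.TTheory GRing.Theory Num.Theory.
Local Open Scope ring_scope.

(* Coordinates of a vertex a = (a_1,...,a_k) are indexed by 'I_k, so that
   the paper's a_1, a_2, a_i (3<=i<=k) are a 0, a 1, a i (2 <= i < k).
   The polynomial families f, g : 'I_k -> {poly F} are only used at
   indices i with 2 <= i (paper's 3 <= i <= k). *)

Definition i1 {k : nat} (h : (2 < k)%N) : 'I_k := Ordinal (ltn_trans (isT : (1 < 2)%N) h).
Definition i0 {k : nat} (h : (2 < k)%N) : 'I_k := Ordinal (ltn_trans (isT : (0 < 2)%N) h).

Definition Sadj (F : finFieldType) (k : nat) (hk : (2 < k)%N)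
    (f g : 'I_k -> {poly F}) : rel {ffun 'I_k -> F} :=
  fun a b =>
    (a (i0 hk) != b (i0 hk)) &&
    [forall i : 'I_k, (2 <= i)%N ==>
       (b i - a i == (g i).[b (i0 hk) - a (i0 hk)] *
                     (f i).[(b (i1 hk) - a (i1 hk)) / (b (i0 hk) - a (i0 hk))])].

Definition connected_graph (T : finType) (e : rel T) : Prop :=
  forall x y : T, connect e x y.

Definition adjmx (T : finType) (e : rel T) : 'M[algC]_(#|T|) :=
  \matrix_(i, j) (e (enum_val i) (enum_val j))%:R.

(* eigenvalues with multiplicity: the roots (with multiplicity) of the
   characteristic polynomial in the algebraically closed field algC *)
Definition eigs (n : nat) (A : 'M[algC]_n) : seq algC :=
  sval (closed_field_poly_normal (char_poly A)).

Definition lambda2 (n : nat) (A : 'M[algC]_n) : algC :=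
  nth 0 (sort (fun x y : algC => y <= x) (eigs A)) 1.

Definition pdeg (F : fieldType) (p : {poly F}) : nat := (size p).-1.
Definition maxdeg (F : fieldType) (k : nat) (f : 'I_k -> {poly F}) : nat :=
  \max_(i < k | (2 <= i)%N) pdeg (f i).

Definition lin_indep_on (F : fieldType) (n : nat) (P : pred 'I_n)
    (h : 'I_n -> {poly F}) : Prop :=
  forall c : 'I_n -> F,
    \sum_(i < n | P i) c i *: h i = 0 -> forall i, P i -> c i = 0.

Definition one_X_f (F : fieldType) (k : nat) (f : 'I_k -> {poly F})
    : 'I_k -> {poly F} :=
  fun i => if val i == 0%N then 1 else if val i == 1%N then 'X else f i.

Definition little_o (a b : nat -> algC) : Prop :=
  forall eps : algC, 0 < eps ->
    exists N : nat, forall m : nat, (N <= m)%N -> `|a m| <= eps * `|b m|.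

(* Main.v *)
(* The graph is a Cayley graph of F^k, so its eigenvalues are the sums
   lambda_w = \sum_t (\sum_u psi (h_{w,t} u) - 1), where psi is a nontrivial additive
   character of F and h_{w,t} = (w_1 + w_2 t) X + \sum_i w_i f_i(t) g_i has degree at
   most d_g < p.  For w != 0 the linear independence hypothesis makes h_{w,t} vanish for
   at most d_f values of t; for the others Weil's bound for the inner sum applies, so
   |lambda_w| <= q + d_f q + d_g q sqrt q.

   Weil's bound is obtained by Stepanov's method.  Let S_n be the character sum of h over
   the extension of F of degree n.  In even degree an auxiliary polynomial gives
   |S_{2n}| <= C q^n with a poor constant C.  The numbers
   A_m = \sum_P psi (\sum_{x root of P} h x), with P monic of degree m, vanish for
   m >= d = deg h and satisfy m A_m = \sum_{n <= m} S_n A_{m-n}; by Newton's identities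
   S_n = - \sum_i omega_i^n for d - 1 complex numbers omega_i, and the bound on S_{2n} for
   all n forces |omega_i| <= sqrt q.

   Connectedness: the trace of h_{w,t}, as a function of u, is a polynomial of degree
   < q, hence not identically zero when h_{w,t} != 0; so no character w != 0 is trivial
   on the connection set. *)
Require Import Defs.
From HB Require Import structures.
From mathcomp Require Import all_boot all_order all_algebra all_field.
From mathcomp Require Import zify ring.
Set Implicit Arguments. Unset Strict Implicit. Unset Printing Implicit Defensive.
Import Order.TTheory GRing.Theory Num.Theory.
Local Open Scope ring_scope.

(** * Frobenius powers and traces *)

(* The trace to the prime field, for [z] in the field of order [p ^ n]. *)
Definition ptrace (R : pzRingType) (p n : nat) (z : R) : R :=
  \sum_(i < n) z ^+ (p ^ i).

Section PrimeChar.
Variables (R : comNzRingType) (p : nat).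
Hypothesis pR : p \in [pchar R].

Lemma pchar_natX n : ([pchar R]).-nat (p ^ n)%N.
Proof.
rewrite (eq_pnat _ (pcharf_eq pR)) pnatX pnat_id //.
exact: pcharf_prime pR.
Qed.

Lemma expnp_gt0 n : (0 < p ^ n)%N.
Proof. by rewrite expn_gt0 (prime_gt0 (pcharf_prime pR)). Qed.

Lemma exprDp n (x y : R) : (x + y) ^+ (p ^ n) = x ^+ (p ^ n) + y ^+ (p ^ n).
Proof. exact: exprDn_pchar (pchar_natX n). Qed.

Lemma exprNp n (x : R) : (- x) ^+ (p ^ n) = - x ^+ (p ^ n).
Proof. exact: exprNn_pchar (pchar_natX n). Qed.

Lemma expr0p n : (0 : R) ^+ (p ^ n) = 0.
Proof. by rewrite expr0n gtn_eqF // expnp_gt0. Qed.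

Lemma expr_sump n (I : Type) (s : seq I) (P : pred I) (G : I -> R) :
  (\sum_(i <- s | P i) G i) ^+ (p ^ n) = \sum_(i <- s | P i) G i ^+ (p ^ n).
Proof.
apply: (big_morph (fun x => x ^+ (p ^ n))); [exact: exprDp | exact: expr0p].
Qed.

Lemma exprnp n k : (k%:R : R) ^+ (p ^ n) = k%:R.
Proof.
elim: n => [|n IHn]; first by rewrite expr1.
by rewrite expnS mulnC exprM IHn -[RHS](pFrobenius_aut_nat pR).
Qed.

Lemma ptraceD n (x y : R) : ptrace p n (x + y) = ptrace p n x + ptrace p n y.
Proof. by rewrite /ptrace -big_split; apply: eq_bigr => i _; rewrite exprDp. Qed.

Lemma ptraceN n (x : R) : ptrace p n (- x) = - ptrace p n x.
Proof. by rewrite /ptrace -sumrN; apply: eq_bigr => i _; rewrite exprNp. Qed.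

Lemma ptrace0 n : ptrace p n 0 = 0 :> R.
Proof. by rewrite /ptrace big1 // => i _; rewrite expr0p. Qed.

Lemma ptraceX n k (x : R) : (ptrace p n x) ^+ (p ^ k) = ptrace p n (x ^+ (p ^ k)).
Proof.
rewrite /ptrace expr_sump; apply: eq_bigr => i _.
by rewrite -!exprM mulnC.
Qed.

Lemma ptrace_addn m n (x : R) : ptrace p (m + n) x = ptrace p m x + (ptrace p n x) ^+ (p ^ m).
Proof.
rewrite {1}/ptrace big_split_ord /= ptraceX; congr (_ + _).
by apply: eq_bigr => i _; rewrite -exprM expnD.
Qed.

(** Transitivity of the trace: on the field of order [p ^ (e * n)], the inner sum is the relative
    trace to the subfield of order [p ^ e]. *)
Lemma ptrace_muln e n (x : R) : ptrace p (e * n) x = ptrace p e (\sum_(i < n) x ^+ ((p ^ e) ^ i)).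
Proof.
elim: n => [|n IHn]; first by rewrite muln0 big_ord0 ptrace0 /ptrace big_ord0.
rewrite mulnS addnC ptrace_addn IHn big_ord_recr ptraceD /= -expnM; congr (_ + _).
by rewrite ptraceX.
Qed.

(** The [p]-th power shifts the terms of the trace cyclically, since the last one becomes
    [x ^+ (p ^ n) = x]. *)
Lemma ptrace_fixed n (x : R) : x ^+ (p ^ n) = x -> (ptrace p n x) ^+ p = ptrace p n x.
Proof.
move=> xE; have -> : ptrace p n x ^+ p = ptrace p n (x ^+ p) by rewrite -(ptraceX n 1 x) expn1.
rewrite {1}/ptrace.
transitivity (\sum_(i < n) x ^+ (p ^ i.+1)).
  by apply: eq_bigr => i _; rewrite -exprM -expnS.
case: n xE => [|n] xE; first by rewrite /ptrace !big_ord0.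
by rewrite /ptrace big_ord_recr big_ord_recl /= xE expn0 expr1 addrC.
Qed.

End PrimeChar.

Lemma ptrace_rmorph (R S : pzRingType) (f : {rmorphism R -> S}) p n x :
  f (ptrace p n x) = ptrace p n (f x).
Proof. by rewrite /ptrace rmorph_sum; apply: eq_bigr => i _; rewrite rmorphXn. Qed.

Lemma horner_ptrace (R : comNzRingType) p n (h : {poly R}) x :
  (ptrace p n h).[x] = ptrace p n h.[x].
Proof. by rewrite /ptrace horner_sum; apply: eq_bigr => i _; rewrite horner_exp. Qed.

Lemma size_polyX_exp (R : idomainType) (h : {poly R}) d n :
  size h = d.+1 -> size (h ^+ n) = (d * n).+1.
Proof.
move=> hd; have h0 : h != 0 by rewrite -size_poly_eq0 hd.
by rewrite -(prednK (n := size _)) ?size_exp ?hd // size_poly_gt0 expf_neq0.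
Qed.

Lemma size_ptrace (R : idomainType) p n (h : {poly R}) d : (1 < p)%N ->
  size h = d.+1 -> (0 < d)%N -> size (ptrace p n.+1 h) = (d * p ^ n).+1.
Proof.
move=> p1 hd d0; elim: n => [|n IHn].
  by rewrite /ptrace big_ord_recr big_ord0 /= add0r expr1 muln1.
rewrite /ptrace big_ord_recr /= addrC size_polyDl (size_polyX_exp _ hd) //.
by rewrite -/(ptrace p n.+1 h) IHn ltnS ltn_mul2l d0 ltn_exp2l /=.
Qed.

(** * Linear relations between polynomials *)

Lemma poly_lin_dep (F : fieldType) (I : finType) (v : I -> {poly F}) D :
  (forall i, size (v i) <= D)%N -> (D < #|I|)%N ->
  exists2 t : I -> F, exists i, t i != 0 & \sum_i t i *: v i = 0.
Proof.
move=> sv DI; pose M := \matrix_(i < #|I|, j < D) (v (enum_val i))`_j.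
have : ~~ row_free M.
  by rewrite -row_leq_rank -ltnNge (leq_ltn_trans (rank_leq_col M)).
rewrite -kermx_eq0 => /rowV0Pn[u /sub_kermxP uM u0].
exists (fun i => u 0 (enum_rank i)).
  by have /rV0Pn[j uj] := u0; exists (enum_val j); rewrite enum_valK.
apply/polyP=> j; rewrite coef0 coef_sum.
have [jD|Dj] := ltnP j D; last first.
  by apply: big1 => i _; rewrite coefZ nth_default ?mulr0 // (leq_trans (sv i)).
rewrite (reindex (enum_val (A := I))) /=; last first.
  by exists enum_rank => x _; rewrite ?enum_valK ?enum_rankK.
have /matrixP/(_ 0 (Ordinal jD)) := uM; rewrite !mxE => uMj.
rewrite -[RHS]uMj; apply: eq_bigr => i _.
by rewrite coefZ enum_valK mxE.
Qed.

(** Among the terms with nonzero coefficient, the one of largest degree cannot be cancelled. *)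
Lemma sum_distinct_size_neq0 (F : fieldType) (I : finType) (s : I -> F)
    (v : I -> {poly F}) :
  injective (fun i => size (v i)) -> (forall i, v i != 0) ->
  (exists i, s i != 0) -> \sum_i s i *: v i != 0.
Proof.
move=> inj_v v0 [i0 si0].
case: (@arg_maxnP I i0 (fun i => s i != 0) (fun i => size (v i)) si0) => i si imax.
rewrite (bigD1 i) //= -size_poly_gt0 size_polyDl size_scale ?size_poly_gt0 //.
apply: (leq_ltn_trans (size_sum _ _ _)).
rewrite -[X in (_ < X)%N](prednK (n := size (v i))) ?size_poly_gt0 // ltnS.
apply/bigmax_leqP=> j ji; rewrite -ltnS prednK ?size_poly_gt0 //.
have [->|sj] := eqVneq (s j) 0; first by rewrite scale0r size_poly0 size_poly_gt0.
rewrite size_scale // ltn_neqAle; apply/andP; split; last exact: imax.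
by apply: contra ji => /eqP/inj_v->.
Qed.

Lemma closed_root_exp (K : closedFieldType) n (a : K) : (0 < n)%N ->
  exists b, b ^+ n == a.
Proof.
move=> n0; have [b bE] := @solve_monicpoly K n (fun i => if i == 0%N then a else 0) n0.
exists b; apply/eqP; rewrite bE; case: n n0 bE => // n _ _.
rewrite big_ord_recl /= expr0 mulr1 big1 ?addr0 // => i _.
by rewrite mul0r.
Qed.

(** * Stepanov's method *)

(** Makes the degrees of the terms of the auxiliary polynomial distinct: [c] is a remainder modulo
    [l], and [b] is then determined modulo [p] because [d] is invertible there. *)
Lemma stepanov_exponent_inj p d l a b c a' b' c' : prime p -> (0 < d < p)%N ->
  (b < p)%N -> (b' < p)%N -> (c < l)%N -> (c' < l)%N ->
  (c + p * l * a + d * l * b = c' + p * l * a' + d * l * b')%N ->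
  [/\ a = a', b = b' & c = c'].
Proof.
move=> pp /andP[d0 dp] bp b'p cl c'l.
have l0 : (0 < l)%N by apply: leq_ltn_trans cl.
have E x y z : (x + p * l * y + d * l * z = (p * y + d * z) * l + x)%N by lia.
rewrite !E => eq1.
have cc : c = c' by have := congr1 (modn^~ l) eq1; rewrite /= !modnMDl !modn_small.
have {eq1}eq1 : (p * a + d * b = p * a' + d * b')%N.
  by have := congr1 (divn^~ l) eq1; rewrite /= !divnMDl // !divn_small // !addn0.
have bb : b = b'.
  have cop : coprime p d by rewrite prime_coprime // gtnNdvd.
  wlog le_bb : a b c a' b' c' bp b'p cl c'l cc eq1 / (b <= b')%N.
    move=> W; case/orP: (leq_total b b') => bb.
      exact: (W a b c a' b' c').
    by symmetry; apply: (W a' b' c' a b c).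
  have : (p %| d * (b' - b))%N.
    apply/dvdnP; exists (a - a')%N; rewrite mulnBr mulnBl; lia.
  rewrite Gauss_dvdr // => /dvdn_leq; case: (ltnP b b') => [lt_bb|]; last lia.
  by rewrite subn_gt0 => /(_ lt_bb); lia.
split=> //; apply/eqP; rewrite -(eqn_pmul2l (prime_gt0 pp)).
by move: eq1; rewrite bb => /addIn->.
Qed.

(* Stepanov's method for [Tr (h x) = 0], with Frobenius [r]-power where [r ^ 2]
   is the order of the field: on that set [U := ptrace p m.+1 h] satisfies
   [U ^ r = - U] and [x ^ (r ^ 2) = x], so the [r]-th power of
   [f := \sum s_abc X^(c + r a) U^b] takes the same values as
   [\sum s_abc^r X^(r c + a) (- U)^b].  Counting unknowns, the latter can be
   made identically zero, while [f != 0] as its terms have distinct degrees. *)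
Lemma stepanov (K : closedFieldType) p m (h : {poly K}) d (Z : seq K) :
  p \in [pchar K] -> size h = d.+1 -> (0 < d < p)%N -> uniq Z ->
  {in Z, forall x, x ^+ (p ^ (m.+1 + m.+1)) = x} ->
  {in Z, forall x, ptrace p (m.+1 + m.+1) h.[x] = 0} ->
  (size Z <= p ^ m.+1 * p ^ m + 2 * d * p ^ m.+1)%N.
Proof.
move=> pK hd d0p uZ ZQ ZT; have pp := pcharf_prime pK; have /andP[d0 dp] := d0p.
have p1 := prime_gt1 pp.
pose l := (p ^ m)%N; pose r := (p ^ m.+1)%N; have rE : r = (p * l)%N by rewrite /r expnS.
have l0 : (0 < l)%N by rewrite expn_gt0 ltnW.
pose U : {poly K} := ptrace p m.+1 h.
have sU : size U = (d * l).+1 by exact: size_ptrace.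
(* The ranges of [a], [b], [c]. The bound [l + d] for [a] gives [r * (l + d)] unknowns, more than
   the [D] coefficients to be annihilated. *)
pose I : finType := ('I_(l + d) * 'I_p * 'I_l)%type.
pose v (i : I) : {poly K} := 'X^(i.2 + r * i.1.1) * U ^+ i.1.2.
pose w (i : I) : {poly K} := 'X^(r * i.2 + i.1.1) * (- U) ^+ i.1.2.
have U0 : U != 0 by rewrite -size_poly_gt0 sU.
have sXM n k (V : {poly K}) : size V = (d * l).+1 ->
    size ('X^n * V ^+ k : {poly K}) = (n + d * l * k).+1.
  move=> sV; rewrite mulrC size_mulXn ?(size_polyX_exp _ sV) ?addnS //.
  by rewrite expf_neq0 // -size_poly_gt0 sV.
have sv i : size (v i) = (i.2 + r * i.1.1 + d * l * i.1.2).+1 by rewrite /v sXM.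
have sw i : size (w i) = (r * i.2 + i.1.1 + d * l * i.1.2).+1.
  by rewrite /w sXM // size_polyN.
have ib (i : I) : [/\ (i.1.1 <= l + d - 1)%N, (i.1.2 <= p - 1)%N & (i.2 <= l - 1)%N].
  by case: i => [[a b] c] /=; split; [have := ltn_ord a|have := ltn_ord b|have := ltn_ord c]; lia.
have dl : (d * l * (p - 1) = d * r - d * l)%N by rewrite mulnBr muln1 rE; congr (_ - _)%N; lia.
have dlr : (d * l <= d * r)%N by rewrite leq_mul2l rE; apply/orP; right; nia.
have lr : (2 * l <= r)%N by rewrite rE leq_mul2r p1 orbT.
pose D := (r * (l - 1) + (l + d - 1) + d * l * (p - 1)).+1.
have [|| t tn0 tw] := @poly_lin_dep K I w D.
- move=> i; have [i1 i2 i3] := ib i; rewrite sw /D ltnS.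
  by rewrite !leq_add // leq_mul2l ?i3 ?i2 orbT.
- rewrite /I !card_prod !card_ord /D dl mulnBr muln1 -mulnA -rE mulnDl.
  have : (d * 1 <= d * l)%N by rewrite leq_mul2l l0 orbT.
  have : (r * 1 <= r * l)%N by rewrite leq_mul2l l0 orbT.
  rewrite !muln1 => ? ?.
  have -> : (l * r = r * l)%N by rewrite mulnC.
  lia.
have r0 : (0 < r)%N by rewrite rE muln_gt0 l0 ltnW.
(* The relation [t] holds between the [w i], whereas [f] needs coefficients whose [r]-th powers are
   the [t i]; they exist as [K] is algebraically closed. *)
pose s (i : I) := xchoose (closed_root_exp (t i) r0).
have sr i : s i ^+ r = t i by exact: (eqP (xchooseP (closed_root_exp (t i) r0))).
pose f := \sum_i s i *: v i.
have f0 : f != 0.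
  apply: sum_distinct_size_neq0.
  - move=> [[a b] c] [[a' b'] c']; rewrite !sv /= => -[]; rewrite rE => E.
    have [] := stepanov_exponent_inj pp d0p (ltn_ord b) (ltn_ord b') (ltn_ord c) (ltn_ord c') E.
    by move=> /ord_inj-> /ord_inj-> /ord_inj->.
  - by move=> i; rewrite -size_poly_gt0 sv.
  - have [i ti] := tn0; exists i; apply: contra ti => /eqP si.
    by rewrite -sr si expr0n gtn_eqF.
have fZ : all (root f) Z.
  apply/allP=> x xZ; rewrite /root.
  suff : f.[x] ^+ r == 0 by rewrite expf_eq0 r0.
  rewrite /f horner_sum (expr_sump pK) -/r.
  rewrite -[X in _ == X](horner0 x) -tw horner_sum; apply/eqP; apply: eq_bigr => i _.
  rewrite !hornerZ exprMn_comm ?sr; last exact: mulrC.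
  congr (_ * _).
  have UxE : U.[x] ^+ r = - U.[x].
    have := ZT x xZ; rewrite (ptrace_addn pK) -horner_ptrace -/U -/r addrC => /eqP.
    by rewrite addr_eq0 => /eqP.
  have xr : x ^+ r ^+ r = x by rewrite -exprM -expnD ZQ.
  rewrite /v /w !hornerM !horner_exp !hornerX hornerN exprMn_comm; last exact: mulrC.
  rewrite -[X in _ * X]exprM (mulnC _ r) exprM UxE; congr (_ * _).
  rewrite -exprM mulnDl !exprD [(_ * r)%N]mulnC; congr (_ * _).
  by rewrite mulnAC !exprM xr.
have := max_poly_roots f0 fZ uZ.
have sf : (size f <= (l - 1 + r * (l + d - 1) + d * l * (p - 1)).+1)%N.
  apply: leq_trans (size_sum _ _ _) _; apply/bigmax_leqP=> i _.
  have [i1 i2 i3] := ib i; apply: leq_trans (size_scale_leq _ _) _.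
  by rewrite sv ltnS !leq_add // leq_mul2l ?i1 ?i2 orbT.
move=> /leq_trans/(_ sf); rewrite ltnS => /leq_trans; apply; rewrite dl -/r -/l.
have -> : (r * (l + d - 1) = r * l + d * r - r)%N.
  by rewrite mulnBr mulnDr muln1 [(d * r)%N]mulnC.
have : (r * 1 <= r * l)%N by rewrite leq_mul2l l0 orbT.
have -> : (2 * d * r = d * r + d * r)%N by rewrite -mulnA mul2n addnn.
rewrite muln1; lia.
Qed.

(** * Bounding the roots of a power sum *)

Lemma bernoulli_ineq (R : numDomainType) (x : R) n : 0 <= x -> 1 + x *+ n <= (1 + x) ^+ n.
Proof.
move=> x0; elim: n => [|n IHn]; first by rewrite mulr0n addr0.
rewrite exprS; apply: le_trans (ler_wpM2l _ IHn); last by rewrite addr_ge0 ?ler01.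
have -> : (1 + x) * (1 + x *+ n) = 1 + x *+ n.+1 + x * (x *+ n) by rewrite mulrS; ring.
by rewrite lerDl mulr_ge0 // mulrn_wge0.
Qed.

(** If [x > B > 0], then [x / B = 1 + y] with [y > 0], and by Bernoulli's inequality its powers
    outgrow the constant [D]. *)
Lemma le_of_exp_bound (x B D : algC) : 0 <= x -> 0 <= B ->
  (forall n, (0 < n)%N -> x ^+ n <= D * B ^+ n) -> x <= B.
Proof.
move=> x0 B0 H; rewrite real_leNgt ?ger0_real //; apply/negP=> ltBx.
have [B00|Bn0] := eqVneq B 0.
  by have := H 1%N isT; rewrite B00 !expr1 mulr0 -B00 => /(lt_le_trans ltBx); rewrite ltxx.
have Bp : 0 < B by rewrite lt_def Bn0.
pose y := x / B - 1; have yp : 0 < y by rewrite subr_gt0 ltr_pdivlMr ?mul1r.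
have Dp : 0 <= D.
  have := H 1%N isT; rewrite !expr1 => /(le_trans x0).
  by rewrite pmulr_lge0.
pose n := (Num.bound (D / y)).+1.
have := H n isT; rewrite -ler_pdivrMr ?exprn_gt0 // -expr_div_n.
have -> : x / B = 1 + y by rewrite /y addrC subrK.
move=> /(le_trans (bernoulli_ineq n (ltW yp))).
have : D < y *+ n.
  rewrite -mulr_natr -ltr_pdivrMl // mulrC.
  have Dy : 0 <= D / y by rewrite divr_ge0 // ltW.
  by rewrite (lt_trans (archi_boundP Dy)) // ltr_nat.
move=> /lt_le_trans H1 H2; have : y *+ n <= D by apply: le_trans H2; rewrite lerDr.
by move=> /H1; rewrite ltxx.
Qed.

(** The power sums are combined with the coefficients of a polynomial [L] that vanishes at every
    value in [ws] other than [w]. Only a nonzero multiple of [w ^+ n] survives, so the single root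
    inherits the exponential bound. *)
Lemma power_sum_bound (ws : seq algC) (B C : algC) : 0 <= B ->
  (forall n, (0 < n)%N -> `|\sum_(w <- ws) w ^+ n| <= C * B ^+ n) ->
  {in ws, forall w, `|w| <= B}.
Proof.
move=> B0 H w ww.
pose L : {poly algC} := \prod_(y <- rem w (undup ws)) ('X - y%:P).
have Lw : L.[w] != 0.
  have := root_prod_XsubC (rem w (undup ws)) w; rewrite -/L /root => ->.
  by rewrite mem_rem_uniqF ?undup_uniq.
have Ly y : y \in ws -> y != w -> L.[y] = 0.
  move=> yw ne; apply/eqP; have := root_prod_XsubC (rem w (undup ws)) y.
  by rewrite -/L /root => ->; rewrite mem_rem_uniq ?undup_uniq // inE ne mem_undup.
pose M := `|L.[w]| *+ count_mem w ws.
have Mp : 0 < M.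
  by rewrite /M pmulrn_lgt0 ?normr_gt0 // -has_count has_pred1.
pose D := (\sum_(j < size L) `|L`_j| * (C * B ^+ j)) / M.
apply: (@le_of_exp_bound _ _ D) => // n n0.
rewrite /D mulrAC ler_pdivlMr //.
have E : \sum_(y <- ws) y ^+ n * L.[y] = (w ^+ n * L.[w]) *+ count_mem w ws.
  rewrite (bigID (pred1 w)) /= [X in _ + X]big1_seq ?addr0; last first.
    by move=> y /andP[ne yw]; rewrite Ly ?mulr0.
  rewrite (eq_bigr (fun=> w ^+ n * L.[w])) => [|y /eqP-> //].
  by rewrite big_const_seq iter_addr_0.
have -> : `|w| ^+ n * M = `|\sum_(y <- ws) y ^+ n * L.[y]|.
  by rewrite E normrMn normrM normrX mulrnAr.
under eq_bigr => y _ do rewrite horner_coef mulr_sumr.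
rewrite exchange_big /= mulr_suml.
apply: le_trans (ler_norm_sum _ _ _) _; apply: ler_sum => j _.
have -> : \sum_(y <- ws) y ^+ n * (L`_j * y ^+ j) = L`_j * \sum_(y <- ws) y ^+ (n + j).
  by rewrite mulr_sumr; apply: eq_bigr => y _; rewrite exprD mulrCA.
rewrite normrM -!mulrA ler_wpM2l // -exprD [(j + n)%N]addnC; apply: H.
by rewrite addn_gt0 n0.
Qed.

Lemma sum_prim_root (R : idomainType) n (z : R) : (1 < n)%N -> n.-primitive_root z ->
  \sum_(i < n) z ^+ i = 0.
Proof.
move=> n1 zp; have := subrX1 z n; rewrite (prim_expr_order zp) subrr => /esym/eqP.
rewrite mulf_eq0 => /orP[|/eqP//]; rewrite subr_eq0 => /eqP z1.
have := prim_order_dvd zp 1; rewrite z1 expr1n eqxx dvdn1.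
by case: n n1 {zp} => [|[|]].
Qed.

(** * Newton's identities *)

(** The reversal of the monic polynomial with roots [s]; its coefficients are the signed elementary
    symmetric functions of [s]. *)
Definition revroots (R : comNzRingType) (s : seq R) : {poly R} :=
  \prod_(x <- s) (1 - x *: 'X).

Definition psum (R : pzRingType) (s : seq R) n : R := \sum_(x <- s) x ^+ n.

Section Newton.
Variable R : comNzRingType.
Implicit Types (s : seq R) (x : R).

Lemma revroots_cons0 x s : (revroots (x :: s))`_0 = (revroots s)`_0.
Proof.
by rewrite /revroots big_cons mulrBl mul1r coefB -scalerAl coefZ coefXM mulr0 subr0.
Qed.

Lemma revroots_consS x s n :
  (revroots (x :: s))`_n.+1 = (revroots s)`_n.+1 - x * (revroots s)`_n.
Proof.
by rewrite /revroots big_cons mulrBl mul1r coefB -scalerAl coefZ coefXM.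
Qed.

Lemma revroots0 s : (revroots s)`_0 = 1.
Proof.
elim: s => [|x s IHs]; first by rewrite /revroots big_nil coef1.
by rewrite revroots_cons0.
Qed.

Lemma coef_revroots_gt s n : (size s < n)%N -> (revroots s)`_n = 0.
Proof.
elim: s n => [|x s IHs] [|n] //= ltn.
  by rewrite /revroots big_nil coef1.
by rewrite revroots_consS !IHs ?mulr0 ?subr0 // ltnW.
Qed.

Lemma coef_revroots s n : (n <= size s)%N ->
  (revroots s)`_n = (\prod_(x <- s) ('X - x%:P))`_(size s - n).
Proof.
elim: s n => [|x s IHs] n /=.
  by rewrite leqn0 => /eqP->; rewrite /revroots !big_nil !coef1.
have sP : size (\prod_(x <- s) ('X - x%:P)) = (size s).+1 by rewrite size_prod_XsubC.
rewrite big_cons mulrBl coefB coefXM coefCM; case: n => [|n] le_n.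
  rewrite revroots0 subn0 /= [_`_(size s).+1]nth_default ?sP // mulr0 subr0.
  by have := IHs 0%N isT; rewrite subn0 revroots0.
rewrite revroots_consS subSS -IHs //; congr (_ - _).
have [->|ne] := eqVneq n (size s); first by rewrite subnn eqxx coef_revroots_gt.
have lt_n : (n < size s)%N by rewrite ltn_neqAle ne.
by rewrite IHs // subn_eq0 leqNgt lt_n /= subnS.
Qed.

(** The identity [x / (1 - x X) * (1 - x X) R = x R] for [R = revroots s], coefficient by
    coefficient. *)
Lemma revroots_cons_psum x s n :
  \sum_(j < n.+1) x ^+ j.+1 * (revroots (x :: s))`_(n - j) = x * (revroots s)`_n.
Proof.
elim: n => [|n IHn].
  by rewrite big_ord_recl big_ord0 addr0 expr1 revroots_cons0.
rewrite big_ord_recl expr1 subn0 revroots_consS.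
under eq_bigr => j _ do rewrite exprS -mulrA subSS.
by rewrite -mulr_sumr IHn mulrBr subrK.
Qed.

(** With [R = revroots s], these are the coefficients of [X R' + R P = 0], where [P] is the
    generating series of the power sums of positive order. Adding one root at a time avoids every
    division. *)
Lemma newton_revroots s n :
  (revroots s)`_n *+ n + \sum_(j < n) psum s j.+1 * (revroots s)`_(n - j.+1) = 0.
Proof.
elim: s n => [|x s IHs] n.
  rewrite /revroots big_nil coef1; case: n => [|n]; first by rewrite big_ord0 mulr0n addr0.
  by rewrite mul0rn add0r big1 // => j _; rewrite /psum big_nil mul0r.
case: n => [|n]; first by rewrite big_ord0 mulr0n addr0.
have -> : \sum_(j < n.+1) psum (x :: s) j.+1 * (revroots (x :: s))`_(n.+1 - j.+1) =
  x * (revroots s)`_n + \sum_(j < n.+1) psum s j.+1 * (revroots (x :: s))`_(n - j).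
  rewrite -revroots_cons_psum -big_split; apply: eq_bigr => j _ /=.
  by rewrite subSS /psum big_cons mulrDl.
have -> : \sum_(j < n.+1) psum s j.+1 * (revroots (x :: s))`_(n - j) =
  \sum_(j < n.+1) psum s j.+1 * (revroots s)`_(n.+1 - j.+1)
  - x * \sum_(j < n) psum s j.+1 * (revroots s)`_(n - j.+1).
  rewrite [in LHS]big_ord_recr [in RHS]big_ord_recr /= !subSS subnn revroots_cons0.
  rewrite [RHS]addrAC; congr (_ + _); rewrite mulr_sumr -sumrB; apply: eq_bigr => j _.
  by rewrite ?subSS -(subnSK (ltn_ord j)) revroots_consS; ring.
have /eqP := IHs n.+1; rewrite addrC addr_eq0 => /eqP->.
have /eqP := IHs n; rewrite addrC addr_eq0 => /eqP->.
by rewrite revroots_consS; ring.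
Qed.

(** In the identity of order [n] the power sum of order [n] has coefficient 1, so the recursion
    determines it over any commutative ring. *)
Lemma psum_revroots_eq s t d : (forall n, (n < d)%N -> (revroots s)`_n = (revroots t)`_n) ->
  forall n, (0 < n < d)%N -> psum s n = psum t n.
Proof.
move=> H n; have [m] := ubnP n; elim: m n => // m IHm n ltnm /andP[n0 nd].
have := etrans (newton_revroots s n) (esym (newton_revroots t n)).
rewrite H // => /addrI.
case: n n0 nd ltnm => // n _ nd ltnm; rewrite !big_ord_recr /= subnn !revroots0 !mulr1.
have -> : \sum_(i < n) psum s i.+1 * (revroots s)`_(n.+1 - i.+1) =
          \sum_(i < n) psum t i.+1 * (revroots t)`_(n.+1 - i.+1).
  apply: eq_bigr => i _; rewrite H; last by lia.
  by rewrite IHm //; have := ltn_ord i; lia.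
by move/addrI.
Qed.

(** In the two identities of order [d] all terms agree except the power sum of order [d] and the
    coefficient of order [d]. *)
Lemma psum_revroots_diff s t d : (0 < d)%N ->
  (forall n, (n < d)%N -> (revroots s)`_n = (revroots t)`_n) ->
  psum s d - psum t d = ((revroots t)`_d - (revroots s)`_d) *+ d.
Proof.
move=> d0 H; have := etrans (newton_revroots s d) (esym (newton_revroots t d)).
case: d d0 H => // d _ H; rewrite !big_ord_recr /= subnn !revroots0 !mulr1.
have -> : \sum_(i < d) psum s i.+1 * (revroots s)`_(d.+1 - i.+1) =
          \sum_(i < d) psum t i.+1 * (revroots t)`_(d.+1 - i.+1).
  apply: eq_bigr => i _; have lti := ltn_ord i; rewrite H; last by lia.
  by rewrite (psum_revroots_eq H) //; lia.
move/eqP; rewrite -subr_eq0 => /eqP E; apply: subr0_eq; rewrite -[RHS]E; ring.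
Qed.

End Newton.

(** * Characters of the prime field *)

(* Maps [n%:R] to [zeta ^+ n], with junk value 0 outside the prime subfield. *)
Definition prime_char (zeta : algC) (p : nat) (R : nzRingType) (z : R) : algC :=
  if [pick n : 'I_p | n%:R == z] is Some n then zeta ^+ n else 0.

Lemma norm_prim_root n (z : algC) : n.-primitive_root z -> `|z| = 1.
Proof.
move=> zp; apply/eqP; rewrite -(pexpr_eq1 (prim_order_gt0 zp)) //.
by rewrite -normrX (prim_expr_order zp) normr1.
Qed.

Section PrimeCharacter.
Variables (zeta : algC) (p : nat) (R : fieldType).
Hypotheses (zeta_p : p.-primitive_root zeta) (pR : p \in [pchar R]).
Local Notation Psi := (@prime_char zeta p R).

Let p_pr : prime p := pcharf_prime pR.

Lemma natr_pchar_inj : {in gtn p &, injective (fun n => n%:R : R)}.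
Proof.
move=> m n /= ltm ltn E.
wlog le_mn : m n ltm ltn E / (m <= n)%N.
  by move=> W; case/orP: (leq_total m n) => /W; [|move=> W'; symmetry]; auto.
have : (p %| n - m)%N by rewrite (dvdn_pcharf pR) natrB // E subrr.
move=> /dvdn_leq; case: (ltnP m n) => [lt_mn|]; last by move: le_mn; clear; lia.
rewrite subn_gt0 => /(_ lt_mn).
by move: (ltn : (n < p)%N) lt_mn; clear; lia.
Qed.

Lemma prime_charE n : Psi n%:R = zeta ^+ n.
Proof.
rewrite /prime_char; case: pickP => [m /eqP E|/(_ (Ordinal (ltn_pmod n (prime_gt0 p_pr))))].
  rewrite -(prim_expr_mod zeta_p n); congr (_ ^+ _).
  apply: natr_pchar_inj; rewrite ?inE ?ltn_ord ?ltn_pmod ?prime_gt0 //.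
  by rewrite (GRing.natr_mod_pchar pR).
by rewrite /= (GRing.natr_mod_pchar pR) ?eqxx.
Qed.

(** The polynomial [X^p - X] has at most [p] roots, and the [n%:R] with [n < p] already are [p] of
    them. *)
Lemma prime_subfieldP (z : R) : z ^+ p = z -> exists2 n : nat, (n < p)%N & z = n%:R.
Proof.
move=> zp; pose P : {poly R} := 'X^p - 'X.
have sP : size P = p.+1.
  by rewrite size_polyDl size_polyXn // size_polyN size_polyX ltnS prime_gt1.
have P0 : P != 0 by rewrite -size_poly_gt0 sP.
pose s : seq R := [seq i%:R | i <- iota 0 p].
have us : uniq s.
  rewrite map_inj_in_uniq ?iota_uniq // => m n; rewrite !mem_iota !add0n => lm ln.
  exact: natr_pchar_inj.
have [zs|zs] := boolP (z \in s).
  by have /mapP[n] := zs; rewrite mem_iota => ln ->; exists n.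
have : (size (z :: s) < size P)%N.
  apply: max_poly_roots => //=; last by rewrite zs.
  rewrite /root !hornerE ?hornerXn zp subrr eqxx /=.
  apply/allP=> _ /mapP[n _ ->]; rewrite /root !hornerE ?hornerXn.
  by rewrite -{1}[p]expn1 (exprnp pR) subrr.
by rewrite /= size_map size_iota sP ltnn.
Qed.

Lemma prime_charD (x y : R) : x ^+ p = x -> y ^+ p = y -> Psi (x + y) = Psi x * Psi y.
Proof.
move=> /prime_subfieldP[m _ ->] /prime_subfieldP[n _ ->].
by rewrite -natrD !prime_charE exprD.
Qed.

Lemma prime_char0 : Psi 0 = 1.
Proof. by rewrite -[0]/(0%:R) prime_charE. Qed.

Lemma prime_char_eq1 (x : R) : x ^+ p = x -> (Psi x == 1) = (x == 0).
Proof.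
move=> /prime_subfieldP[m _ ->].
by rewrite prime_charE -(prim_order_dvd zeta_p) (dvdn_pcharf pR).
Qed.

Lemma norm_prime_char (x : R) : x ^+ p = x -> `|Psi x| = 1.
Proof.
move=> /prime_subfieldP[m _ ->]; rewrite prime_charE normrX.
by rewrite (norm_prim_root zeta_p) expr1n.
Qed.

End PrimeCharacter.

Lemma prime_char_rmorph (zeta : algC) p (R : fieldType) (S : nzRingType)
    (f : {rmorphism R -> S}) (x : R) :
  prime_char zeta p (f x) = prime_char zeta p x.
Proof.
have E : (fun n : 'I_p => n%:R == f x) =1 (fun n : 'I_p => n%:R == x).
  by move=> n; rewrite -(rmorph_nat f) (inj_eq (fmorph_inj f)).
by rewrite /prime_char (eq_pick E).
Qed.

(* Every level set of [Tr \o h] has at most [N := r^2 / p + 2 d r] elements;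
   as they partition [E], the sum of [N - #level set] over the [p] levels is
   exactly [2 d p r], and [\sum_c zeta ^ c = 0]. *)
Lemma trace_char_sum_square_bound (K : closedFieldType) (zeta : algC) p m (h : {poly K}) d
    (E : seq K) :
  p.-primitive_root zeta -> p \in [pchar K] -> size h = d.+1 -> (0 < d < p)%N ->
  uniq E -> size E = (p ^ (m.+1 + m.+1))%N ->
  {in E, forall x, x ^+ (p ^ (m.+1 + m.+1)) = x} ->
  {in E, forall x, h.[x] ^+ (p ^ (m.+1 + m.+1)) = h.[x]} ->
  `|\sum_(x <- E) prime_char zeta p (ptrace p (m.+1 + m.+1) h.[x])|
     <= (2 * d * p * p ^ m.+1)%:R.
Proof.
move=> zp pK hd d0p uE sE EQ Eh; have pp := pcharf_prime pK; have /andP[d0 dp] := d0p.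
have p1 := prime_gt1 pp; set N := (m.+1 + m.+1)%N in sE EQ Eh *.
pose T x := ptrace p N h.[x].
have TE x : x \in E -> T x ^+ p = T x by move=> xE; apply: (ptrace_fixed pK); apply: Eh.
pose n (c : 'I_p) := count (fun x => T x == c%:R) E.
pose B := (p ^ m.+1 * p ^ m + 2 * d * p ^ m.+1)%N.
have nB c : (n c <= B)%N.
  (* Subtracting from [h] some [a] in [K] of trace [c], which need not lie in [E], turns the level
     set of [c] into a zero set, to which Stepanov's bound applies. *)
  have [a aE] : exists a : K, ptrace p N a = c%:R.
    pose P : {poly K} := ptrace p N 'X - c%:R%:P.
    have sX : size (ptrace p N ('X : {poly K})) = (p ^ (m + m.+1)).+1.
      by rewrite /N addSn (@size_ptrace _ _ _ _ 1%N) ?size_polyX ?mul1n.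
    have sP : size P = (p ^ (m + m.+1)).+1.
      rewrite /P size_polyDl sX // size_polyN (leq_ltn_trans (size_polyC_leq1 _)) //.
      by rewrite ltnS expn_gt0 ltnW.
    have /closed_rootP[a] : size P != 1%N by rewrite sP eqSS -lt0n expn_gt0 ltnW.
    rewrite /root /P !hornerE horner_ptrace hornerX subr_eq0 => /eqP Ea.
    by exists a.
  rewrite /n -size_filter.
  have hd' : size (h - a%:P) = d.+1.
    by rewrite size_polyDl hd // size_polyN (leq_ltn_trans (size_polyC_leq1 _)).
  apply: (@stepanov K p m (h - a%:P) d) => //; first exact: filter_uniq.
    by move=> x; rewrite mem_filter => /andP[_ /EQ].
  move=> x; rewrite mem_filter => /andP[/eqP Tx _].
  by rewrite !hornerE (ptraceD pK) (ptraceN pK) -/N aE -/(T x) Tx subrr.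
have Tlevel x : x \in E -> exists c0 : 'I_p,
    T x = c0%:R /\ forall c : 'I_p, (T x == c%:R) = (c == c0).
  move=> /TE/(prime_subfieldP pK)[k ltk Tk]; exists (Ordinal ltk); split=> // c.
  rewrite Tk; apply/eqP/eqP => [Ek|->] //; apply: val_inj.
  by apply: (natr_pchar_inj pK); rewrite ?inE /= ?ltn_ord ?Ek.
have sumn : (\sum_c n c = p ^ N)%N.
  rewrite -sE /n; under eq_bigr => c _ do rewrite -sum1_count big_mkcond.
  rewrite exchange_big /= -sum1_size [LHS]big_seq [RHS]big_seq.
  apply: eq_bigr => x /Tlevel[c0 [_ Tc]].
  by rewrite (bigD1 c0) //= Tc eqxx big1 // => c; rewrite Tc => /negbTE->.
have -> : \sum_(x <- E) prime_char zeta p (T x) = \sum_(c < p) (n c)%:R * zeta ^+ c.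
  transitivity (\sum_(c < p) \sum_(x <- E) if T x == c%:R then zeta ^+ c else 0).
    rewrite exchange_big /= big_seq [RHS]big_seq.
    apply: eq_bigr => x /Tlevel[c0 [Tx Tc]].
    rewrite (bigD1 c0) //= Tc eqxx Tx (prime_charE zp pK) big1 ?addr0 // => c.
    by rewrite -Tx Tc => /negbTE->.
  apply: eq_bigr => c _; rewrite -big_mkcond big_const_seq iter_addr_0.
  by rewrite mulr_natl.
have -> : \sum_(c < p) (n c)%:R * zeta ^+ c = \sum_(c < p) ((n c)%:R - B%:R) * zeta ^+ c.
  under [RHS]eq_bigr => c _ do rewrite mulrBl.
  by rewrite sumrB -mulr_sumr (sum_prim_root p1 zp) mulr0 subr0.
apply: le_trans (ler_norm_sum _ _ _) _.
under eq_bigr => c _ do rewrite normrM normrX (norm_prim_root zp) expr1n mulr1.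
rewrite (eq_bigr (fun c => (B - n c)%:R)); last first.
  by move=> c _; rewrite distrC -natrB // normr_nat.
rewrite -natr_sum ler_nat.
have : (\sum_(c < p) (B - n c) + \sum_c n c = p * B)%N.
  rewrite -big_split /= (eq_bigr (fun=> B)) => [|c _]; last by rewrite subnK.
  by rewrite sum_nat_const card_ord.
have -> : (p * B = p ^ N + 2 * d * p * p ^ m.+1)%N.
  rewrite /B mulnDr; congr (_ + _)%N; last by lia.
  by rewrite mulnCA -expnS -expnD.
by rewrite sumn addnC => /addnI->.
Qed.

(** * Counting orbits in an invariant multiset *)

Definition submultiset (T : eqType) (a s : seq T) : bool :=
  all (fun y => count_mem y a <= count_mem y s)%N a.

Lemma submultisetP (T : eqType) (a s : seq T) :
  reflect (forall y, (count_mem y a <= count_mem y s)%N) (submultiset a s).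
Proof.
apply: (iffP allP) => [H y|H y _ //].
have [/H //|ya] := boolP (y \in a).
by rewrite (count_memPn ya).
Qed.

Lemma submultiset_size (T : eqType) (a s : seq T) : submultiset a s -> (size a <= size s)%N.
Proof.
move/submultisetP; elim: a s => //= x a IHa s H.
have xs : x \in s by rewrite -has_pred1 has_count (leq_trans _ (H x)) //= eqxx.
have p := perm_to_rem xs; rewrite (perm_size p) /= ltnS; apply: IHa => z.
by have := H z; rewrite (permP p) /= leq_add2l.
Qed.

Section OrbitCount.
Variables (T : eqType) (phi : T -> T) (s : seq T).
Hypotheses (phi_inj : injective phi) (s_phi : perm_eq (map phi s) s).

Let count_phi y : count_mem (phi y) s = count_mem y s.
Proof.
have /permP/(_ (pred1 (phi y))) <- := s_phi.
by rewrite count_map; apply: eq_count => z; rewrite /= (inj_eq phi_inj).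
Qed.

Let count_iter n y : count_mem (iter n phi y) s = count_mem y s.
Proof. by elim: n => //= n IHn; rewrite count_phi. Qed.

Let iter_inj n : injective (iter n phi).
Proof. by elim: n => //= n IHn x y /phi_inj/IHn. Qed.

Let ex_period x : x \in s -> exists n, (0 < n)%N && (iter n phi x == x).
Proof.
move=> xs; have /loopingP/(_ (size s)) : looping phi x (size s).
  apply/negPn; rewrite -looping_uniq; apply/negP=> u.
  suff /(uniq_leq_size u) : {subset traject phi x (size s).+1 <= s}.
    by rewrite size_traject ltnn.
  move=> y /trajectP[i _ ->].
  by rewrite -has_pred1 has_count count_iter -has_count has_pred1.
move=> /trajectP[i lti E]; exists (size s - i)%N; rewrite subn_gt0 lti /=.
apply/eqP; apply: (@iter_inj i); by rewrite -iterD subnKC ?E // ltnW.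
Qed.

Lemma sum_dvdn_lt d N : (0 < d)%N -> (\sum_(n < N) (d %| n.+1) = N %/ d)%N.
Proof.
move=> d0; elim: N => [|N IHN]; first by rewrite big_ord0 div0n.
by rewrite big_ord_recr /= IHN divnS // addnC.
Qed.

(** Let [d] be the exact period of [x]. A path of [n.+1] steps returns to [x] when it makes [k] full
    turns, [n.+1 = k * d], and it fits into [s] when [k] is at most the multiplicity of [x]. That
    multiplicity is therefore the number of admissible [n]. *)
Let orbit_count x : x \in s ->
  (\sum_(n < size s) ((iter n.+1 phi x == x) && submultiset (traject phi x n.+1) s)
     = count_mem x s)%N.
Proof.
move=> xs; case: (ex_minnP (ex_period xs)) => d /andP[d0 /eqP dx] dmin.
have iter_mul k : iter (k * d) phi x = x.
  by elim: k => // k IHk; rewrite mulSn iterD IHk dx.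
have perE n : (iter n phi x == x) = (d %| n)%N.
  apply/eqP/idP => [nx|/dvdnP[k ->]]; last exact: iter_mul.
  apply: contraLR (ltn_pmod n d0); rewrite /dvdn -leqNgt -lt0n => r0.
  by apply: dmin; rewrite r0 -[X in _ == X]nx {2}(divn_eq n d) addnC iterD iter_mul eqxx.
have uT : uniq (traject phi x d).
  case: d d0 {dx iter_mul} dmin perE => // d _ dmin perE.
  rewrite looping_uniq; apply/negP=> /loopingP/(_ d)/trajectP[i lti E].
  have Ei : iter (d - i) phi x = x.
    by apply: (@iter_inj i); rewrite -iterD subnKC ?(ltnW lti) // E.
  by have := dmin (d - i)%N; rewrite subn_gt0 lti Ei eqxx => /(_ isT); lia.
pose mu := count_mem x s.
have count_T k y : count_mem y (traject phi x (k * d)) = (k * (y \in traject phi x d))%N.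
  elim: k => // k IHk; rewrite !mulSn trajectD count_cat dx IHk.
  by rewrite count_uniq_mem.
have xT : x \in traject phi x d by case: (d) d0 => // ? _; rewrite inE eqxx.
have sub k : submultiset (traject phi x (k * d)) s = (k <= mu)%N.
  apply/submultisetP/idP => [/(_ x)|le_k y]; first by rewrite count_T xT muln1.
  rewrite count_T; case: trajectP => [[i _ ->]|_]; last by rewrite muln0.
  by rewrite muln1 count_iter.
(* Ensures that the range [n < size s] contains all admissible path lengths. *)
have le_mud : (mu * d <= size s)%N.
  have := sub mu; rewrite leqnn => /submultiset_size.
  by rewrite size_traject.
rewrite -[RHS](mulnK mu d0) -sum_dvdn_lt //.
rewrite (big_ord_widen _ (fun n => nat_of_bool (d %| n.+1)%N) le_mud) [RHS]big_mkcond.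
apply: eq_bigr => n _; rewrite perE.
have [/dvdnP[k kE]|_] := boolP (d %| n.+1)%N; last by case: ifP.
by rewrite kE sub leq_pmul2r //; case: (k <= mu)%N.
Qed.

(** Applied to the roots of a monic polynomial of degree [m], this count supplies the factor [m] in
    [Lcoef_rec]. *)
Lemma orbit_count_total :
  (\sum_(n < size s) count (fun x =>
      (iter n.+1 phi x == x) && submultiset (traject phi x n.+1) s) (undup s)
    = size s)%N.
Proof.
under eq_bigr => n _ do rewrite -sum1_count big_mkcond /=.
rewrite exchange_big /= big_seq.
rewrite (eq_bigr (fun x => count_mem x s)) => [|x]; last first.
  rewrite mem_undup => xs; rewrite -(orbit_count xs).
  by apply: eq_bigr => n _; case: ifP.
rewrite -big_seq -[RHS]sum1_size -[RHS]big_undup_iterop_count /=.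
apply: eq_bigr => x _; rewrite Monoid.iteropE iter_addn_0 mul1n //.
Qed.

End OrbitCount.

(** * Monic polynomials over a finite field *)

Lemma dvdp_prod_XsubC_submultiset (K : fieldType) (a s : seq K) :
  (\prod_(x <- a) ('X - x%:P) %| \prod_(x <- s) ('X - x%:P)) = submultiset a s.
Proof.
have nz t : \prod_(x <- t) ('X - x%:P) != 0 :> {poly K}.
  by rewrite monic_neq0 ?monic_prod_XsubC.
apply/idP/submultisetP => [/dvdpP[u uE] y|].
  have u0 : u != 0 by apply: contraTneq (nz s) => u0; rewrite uE u0 mul0r eqxx.
  by rewrite -!mu_prod_XsubC uE mupM // leq_addl.
elim: a s => [|x a IHa] s H; first by rewrite big_nil dvd1p.
have xs : x \in s by rewrite -has_pred1 has_count (leq_trans _ (H x)) //= eqxx.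
have p := perm_to_rem xs; rewrite (perm_big _ p) /= !big_cons dvdp_mul2l ?polyXsubC_eq0 //.
by apply: IHa => z; have := H z; rewrite (permP p) /= leq_add2l.
Qed.

Definition monic_rV (R : nzRingType) m (c : 'rV[R]_m) : {poly R} := 'X^m + rVpoly c.

Section MonicRV.
Variable F : fieldType.

Lemma size_rVpoly_lt m (c : 'rV[F]_m) : (size (rVpoly c) < size ('X^m : {poly F}))%N.
Proof. by rewrite size_polyXn ltnS size_poly. Qed.

Lemma size_monic_rV m (c : 'rV[F]_m) : size (monic_rV c) = m.+1.
Proof. by rewrite /monic_rV size_polyDl ?size_rVpoly_lt // size_polyXn. Qed.

Lemma monic_rV_monic m (c : 'rV[F]_m) : monic_rV c \is monic.
Proof.
by rewrite monicE lead_coefDl ?size_rVpoly_lt // lead_coefXn.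
Qed.

Lemma monic_rVK m : cancel (@monic_rV F m) (fun P => poly_rV (P - 'X^m)).
Proof. by move=> c; rewrite /monic_rV addrC addKr rVpolyK. Qed.

Lemma poly_rV_monicK m (P : {poly F}) : P \is monic -> size P = m.+1 ->
  monic_rV (poly_rV (P - 'X^m) : 'rV_m) = P.
Proof.
move=> Pm Ps; rewrite /monic_rV poly_rV_K ?subrKC //.
apply/leq_sizeP => j lej; rewrite coefB coefXn.
have [->|ne] := eqVneq j m.
  by have /monicP := Pm; rewrite /lead_coef Ps /= => ->; rewrite subrr.
by rewrite subr0 nth_default // Ps ltn_neqAle eq_sym ne.
Qed.

End MonicRV.

(** Multiplication by [P] is a bijection from the monic polynomials of degree [m - n] onto the monic
    multiples of [P] of degree [m]. *)
Lemma sum_monic_dvd (F : finFieldType) (V : nmodType) m n (P : {poly F})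
    (f : {poly F} -> V) :
  P \is monic -> size P = n.+1 -> (n <= m)%N ->
  \sum_(c : 'rV[F]_m | P %| monic_rV c) f (monic_rV c) =
  \sum_(c : 'rV[F]_(m - n)) f (P * monic_rV c).
Proof.
move=> Pm Ps le_nm; have P0 := monic_neq0 Pm.
have sM (c : 'rV[F]_(m - n)) : size (P * monic_rV c) = m.+1.
  by rewrite size_mul ?monic_neq0 ?monic_rV_monic // Ps size_monic_rV /=; lia.
have mM (c : 'rV[F]_(m - n)) : P * monic_rV c \is monic.
  by rewrite rpredM ?monic_rV_monic.
rewrite (reindex_onto (fun c : 'rV[F]_(m - n) => poly_rV (P * monic_rV c - 'X^m))
  (fun c : 'rV[F]_m => poly_rV (monic_rV c %/ P - 'X^(m - n)))) /=.
  apply: eq_big => [c|c _]; rewrite poly_rV_monicK //.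
  by rewrite dvdp_mulr //= mulKp // monic_rVK eqxx.
move=> c dvd; rewrite (poly_rV_monicK (P := monic_rV c %/ P)).
- by rewrite mulrC divpK // monic_rVK.
- by rewrite -(monicMl _ Pm) mulrC divpK // monic_rV_monic.
- by rewrite size_divp // Ps size_monic_rV /=; lia.
Qed.

Definition closed_roots (K : closedFieldType) (P : {poly K}) : seq K :=
  sval (closed_field_poly_normal P).

Lemma closed_rootsE (K : closedFieldType) (P : {poly K}) : P \is monic ->
  P = \prod_(x <- closed_roots P) ('X - x%:P).
Proof.
move=> Pm; rewrite /closed_roots; case: closed_field_poly_normal => s /= {1}->.
by rewrite (monicP Pm) scale1r.
Qed.

Lemma size_closed_roots (K : closedFieldType) (P : {poly K}) n : P \is monic ->
  size P = n.+1 -> size (closed_roots P) = n.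
Proof. by move=> /closed_rootsE {1}->; rewrite size_prod_XsubC => -[]. Qed.

(** * The L-function of an additive character sum *)

(** The proof [pR] is an argument so that the ring morphism instances can be attached to this
    function. *)
Definition frob (R : comNzRingType) p (pR : p \in [pchar R]) n (x : R) := x ^+ (p ^ n).

Section FrobMorphism.
Variables (R : comNzRingType) (p : nat) (pR : p \in [pchar R]) (n : nat).

Fact frob_is_nmod_morphism : nmod_morphism (frob pR n).
Proof. by split=> [|x y]; rewrite /frob ?(expr0p pR) ?(exprDp pR). Qed.

Fact frob_is_monoid_morphism : monoid_morphism (frob pR n).
Proof. by split=> [|x y]; rewrite /frob ?expr1n ?exprMn. Qed.

HB.instance Definition _ := GRing.isNmodMorphism.Build R R (frob pR n) frob_is_nmod_morphism.
HB.instance Definition _ := GRing.isMonoidMorphism.Build R R (frob pR n) frob_is_monoid_morphism.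

Lemma iter_frob i x : iter i (frob pR n) x = x ^+ ((p ^ n) ^ i).
Proof. by elim: i => //= i ->; rewrite /frob -exprM -expnSr. Qed.

End FrobMorphism.

(** As a polynomial in [u] the trace has degree at most [(p - 1) * p ^ (e - 1)], less than the order
    of [F], so it cannot vanish everywhere. *)
Lemma exists_ptrace_neq0 (F : finFieldType) p e (h : {poly F}) :
  p \in [pchar F] -> #|F| = (p ^ e)%N -> (1 < size h <= p)%N ->
  exists u, ptrace p e h.[u] != 0.
Proof.
move=> pF cF /andP[h1 hp]; apply/existsP.
apply: negbNE; rewrite negb_exists; apply/negP=> /forallP H.
have p1 := prime_gt1 (pcharf_prime pF).
case: e cF H => [|e] cF H; first by have := finNzRing_gt1 F; rewrite cF.
have sh : size h = (size h).-1.+1 by rewrite prednK // ltnW.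
have sT : size (ptrace p e.+1 h) = ((size h).-1 * p ^ e).+1.
  by apply: size_ptrace => //; rewrite -ltnS -sh.
have : (size (enum F) < size (ptrace p e.+1 h))%N.
  apply: max_poly_roots; rewrite ?enum_uniq //; first by rewrite -size_poly_gt0 sT.
  by apply/allP=> u _; rewrite /root horner_ptrace; have := H u; rewrite negbK.
rewrite -cardE cF sT ltnS expnS leq_pmul2r ?expn_gt0 ?(ltnW p1) //; lia.
Qed.

Section LFunction.
Variables (F : finFieldType) (K : closedFieldType) (iota : {rmorphism F -> K}).
Variables (p e d : nat) (zeta : algC) (h : {poly F}).
Hypotheses (zeta_p : p.-primitive_root zeta) (pF : p \in [pchar F]).
Hypotheses (cardF : #|F| = (p ^ e)%N) (h_d : size h = d.+1) (d0p : (0 < d < p)%N).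

Let q := (p ^ e)%N.
Let pK : p \in [pchar K]. Proof. exact: (rmorph_pchar iota). Qed.
Let phi : {rmorphism K -> K} := frob pK e.
Let p1 : (1 < p)%N := prime_gt1 (pcharf_prime pF).
Let Psi := @prime_char zeta p K.

Let q1 : (1 < q)%N. Proof. by rewrite /q -cardF finNzRing_gt1. Qed.

Let qn1 n : (0 < n)%N -> (1 < q ^ n)%N.
Proof. by move=> n0; apply: leq_ltn_trans n0 (ltn_expl n q1). Qed.

Let phi_inj : injective phi. Proof. exact: fmorph_inj. Qed.

Let phi_iota a : phi (iota a) = iota a.
Proof. by rewrite /phi /= /frob -rmorphXn -cardF expf_card. Qed.

Let phi_map (P : {poly F}) : map_poly phi (map_poly iota P) = map_poly iota P.
Proof. by rewrite -map_poly_comp; apply: eq_map_poly => a; rewrite /= phi_iota. Qed.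

(** A fixed point is a root of [X^q - X], which is the product of the [X - a] over all [a] in
    [F]. *)
Let fixed_iota x : phi x = x -> exists a, x = iota a.
Proof.
move=> xq; have := congr1 (map_poly iota) (finField_genPoly F).
rewrite rmorphB /= map_polyXn map_polyX rmorph_prod /=.
move/(congr1 (horner^~ x)); rewrite !hornerE ?hornerXn cardF -/(frob pK e x).
rewrite -[frob pK e x]/(phi x) xq subrr horner_prod => /esym/eqP/prodf_eq0[a _].
by rewrite map_polyXsubC hornerXsubC subr_eq0 => /eqP->; exists a.
Qed.

(* The extension of [F] of degree [n], inside the algebraically closed [K]. *)
Definition fixed_pts n : seq K := closed_roots ('X^(q ^ n) - 'X).

Let gen_size n : (0 < n)%N -> size ('X^(q ^ n) - 'X : {poly K}) = (q ^ n).+1.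
Proof.
move=> n0; rewrite size_polyDl size_polyXn // size_polyN size_polyX ltnS.
exact: qn1.
Qed.

Let gen_monic n : (0 < n)%N -> ('X^(q ^ n) - 'X : {poly K}) \is monic.
Proof.
move=> n0; rewrite monicE lead_coefDl ?lead_coefXn // size_polyN size_polyX size_polyXn ltnS.
exact: qn1.
Qed.

Lemma size_fixed_pts n : (0 < n)%N -> size (fixed_pts n) = (q ^ n)%N.
Proof. by move=> n0; apply: size_closed_roots; [exact: gen_monic|exact: gen_size]. Qed.

Lemma mem_fixed_pts n x : (0 < n)%N -> (x \in fixed_pts n) = (iter n phi x == x).
Proof.
move=> n0; rewrite -root_prod_XsubC -closed_rootsE ?gen_monic //.
by rewrite /root !hornerE ?hornerXn subr_eq0 iter_frob.
Qed.

(** The derivative of [X^(q^n) - X] is [-1], so the roots are simple. *)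
Lemma uniq_fixed_pts n : (0 < n)%N -> uniq (fixed_pts n).
Proof.
move=> n0; rewrite -separable_prod_XsubC -closed_rootsE ?gen_monic //.
rewrite unlock derivB derivXn derivX -mulr_natr.
have -> : (q ^ n)%:R = 0 :> {poly K}.
  apply/eqP; rewrite -(rmorph_nat (@polyC K)) polyC_eq0 -(dvdn_pcharf pK).
  rewrite /q -expnM dvdn_exp // muln_gt0 n0 andbT.
  by move: q1; rewrite /q; case: e.
by rewrite mulr0 sub0r -[X in coprimep _ X]scaleN1r coprimepZr ?coprimep1 // oppr_eq0 oner_eq0.
Qed.

Let hK := map_poly iota h.

Let phi_hK x : phi hK.[x] = hK.[phi x].
Proof. by rewrite -horner_map phi_map. Qed.

Let iter_phi_hK i x : iter i phi hK.[x] = hK.[iter i phi x].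
Proof. by elim: i => //= i IHi; rewrite -phi_hK -IHi. Qed.

Lemma expr_fixed_pts n x : (0 < n)%N -> x \in fixed_pts n -> x ^+ (p ^ (e * n)) = x.
Proof. by move=> n0; rewrite mem_fixed_pts // iter_frob -expnM => /eqP. Qed.

Lemma horner_fixed_pts n x : (0 < n)%N -> x \in fixed_pts n ->
  hK.[x] ^+ (p ^ (e * n)) = hK.[x].
Proof.
move=> n0; rewrite mem_fixed_pts // => /eqP xn.
by rewrite expnM -(iter_frob pK) -/phi iter_phi_hK xn.
Qed.

Definition root_sum (s : seq K) : K := \sum_(x <- s) hK.[x].
(** For monic [P], [phi] permutes the roots and so fixes the root sum; its trace lies in the prime
    field, where [prime_char] does not take its default value 0. *)
Definition root_char (P : {poly F}) : algC :=
  Psi (ptrace p e (root_sum (closed_roots (map_poly iota P)))).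

Let ptrace_fix z : phi z = z -> ptrace p e z ^+ p = ptrace p e z.
Proof. by move=> zE; apply: (ptrace_fixed pK). Qed.

Let iota_monic (P : {poly F}) : P \is monic -> map_poly iota P \is monic.
Proof. by rewrite map_monic. Qed.

Let perm_phi (P : {poly F}) s : map_poly iota P = \prod_(x <- s) ('X - x%:P) ->
  perm_eq (map phi s) s.
Proof.
move=> Ps; apply: prod_XsubC_eq; rewrite big_map -map_prod_XsubC -Ps.
exact: phi_map.
Qed.

Let root_sum_fixed (P : {poly F}) s : map_poly iota P = \prod_(x <- s) ('X - x%:P) ->
  phi (root_sum s) = root_sum s.
Proof.
move=> /perm_phi Ps; rewrite /root_sum rmorph_sum /= -[RHS](perm_big _ Ps) big_map /=.
by apply: eq_bigr => x _; rewrite -phi_hK.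
Qed.

Lemma root_charE (P : {poly F}) s : map_poly iota P = \prod_(x <- s) ('X - x%:P) ->
  root_char P = Psi (ptrace p e (root_sum s)).
Proof.
move=> Ps; have Pm : map_poly iota P \is monic by rewrite Ps monic_prod_XsubC.
have /prod_XsubC_eq Eq := etrans (esym (closed_rootsE Pm)) Ps.
by rewrite /root_char /root_sum (perm_big _ Eq).
Qed.

Lemma root_charM (P Q : {poly F}) : P \is monic -> Q \is monic ->
  root_char (P * Q) = root_char P * root_char Q.
Proof.
move=> /iota_monic/closed_rootsE Ps /iota_monic/closed_rootsE Qs.
rewrite (@root_charE _ (closed_roots (map_poly iota P) ++ closed_roots (map_poly iota Q))).
  rewrite /root_sum big_cat (ptraceD pK) /= [LHS](prime_charD zeta_p pK) //.
    exact: ptrace_fix (root_sum_fixed Ps).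
  exact: ptrace_fix (root_sum_fixed Qs).
by rewrite rmorphM big_cat /= -Ps -Qs.
Qed.

(* [Lcoef m] and [ext_char_sum n] are the [A_m] and [S_n] of the introduction. *)
Definition Lcoef m : algC := \sum_(c : 'rV[F]_m) root_char (monic_rV c).
Definition ext_char_sum n : algC := \sum_(x <- fixed_pts n) Psi (ptrace p (e * n) hK.[x]).

Lemma ext_char_sum1 : ext_char_sum 1 = \sum_(a : F) prime_char zeta p (ptrace p e h.[a]).
Proof.
have E : perm_eq (fixed_pts 1) [seq iota a | a <- enum F].
  apply: uniq_perm; first exact: uniq_fixed_pts.
    by rewrite map_inj_uniq ?enum_uniq //; apply: fmorph_inj.
  move=> x; rewrite mem_fixed_pts //; apply/eqP/mapP => [/fixed_iota[a ->]|[a _ ->]].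
    by exists a; rewrite ?mem_enum.
  exact: phi_iota.
rewrite /ext_char_sum (perm_big _ E) big_map big_enum /=; apply: eq_bigr => a _.
by rewrite horner_map -ptrace_rmorph muln1 /Psi prime_char_rmorph.
Qed.

Lemma Lcoef0 : Lcoef 0 = 1.
Proof.
rewrite /Lcoef (big_pred1 0) => [|c]; last by rewrite /= [c]thinmx0 eqxx.
rewrite (@root_charE _ [::]) /root_sum ?big_nil ?(ptrace0 pK) ?[LHS](prime_char0 zeta_p pK) //.
by rewrite /monic_rV linear0 addr0 expr0 rmorph1 ?big_nil.
Qed.

(** The product over a closed path of [phi] is fixed by [phi], so its coefficients come from [F].
    The path may run round the orbit several times. *)
Let orbit_poly x n : (0 < n)%N -> x \in fixed_pts n ->
  {P : {poly F} | map_poly iota P = \prod_(y <- traject phi x n) ('X - y%:P)}.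
Proof.
move=> n0; rewrite mem_fixed_pts // => /eqP xn.
pose G : {poly K} := \prod_(y <- traject phi x n) ('X - y%:P).
have G_phi : map_poly phi G = G.
  rewrite /G map_prod_XsubC /= -(big_map phi predT (fun y => 'X - y%:P)).
  have -> : map phi (traject phi x n) = traject phi (phi x) n.
    by elim: (n) (x) => //= k IHk y; rewrite IHk.
  apply: perm_big; rewrite -(perm_cons x) -[x :: _]/(traject phi x n.+1) trajectSr xn.
  by rewrite perm_rcons.
pose g (y : K) : F := odflt 0 [pick a | iota a == y].
have gK y : phi y = y -> iota (g y) = y.
  move=> /fixed_iota[a ya]; rewrite /g; case: pickP => [b /eqP //|/(_ a)].
  by rewrite ya eqxx.
exists (map_poly g G); apply/polyP=> i.
have g0 : g 0 = 0 by apply: (fmorph_inj iota); rewrite gK rmorph0.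
rewrite coef_map coef_map_id0 // [LHS]gK //.
by rewrite -[in RHS]G_phi coef_map.
Qed.

Let root_sum_psum s : root_sum s = \sum_(j < d.+1) hK`_j * psum s j.
Proof.
rewrite /root_sum; under eq_bigr => x _ do rewrite horner_coef size_map_poly h_d.
by rewrite exchange_big; apply: eq_bigr => j _; rewrite mulr_sumr.
Qed.

(* Moving the coefficient of [X^(m - d)] of [P] leaves the power sums of the
   roots of order [< d] unchanged and moves the one of order [d] linearly. *)
Lemma Lcoef_ge m : (d <= m)%N -> Lcoef m = 0.
Proof.
move=> le_dm; have /andP[d0 dp] := d0p.
have [u] : exists u, ptrace p e ('X : {poly F}).[u] != 0.
  by apply: exists_ptrace_neq0 => //; rewrite size_polyX.
rewrite hornerX => Tu.
have hd0 : h`_d != 0.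
  by have := lead_coef_eq0 h; rewrite /lead_coef h_d /= -size_poly_eq0 h_d => ->.
have dF : d%:R != 0 :> F by rewrite -(dvdn_pcharf pF) gtnNdvd.
have lt_i : (m - d < m)%N by lia.
(* The index [i] is that of the coefficient of [X^(m - d)]; [b] is scaled so that the shift adds
   exactly [u], an element of nonzero trace, to the root sum. *)
pose i := Ordinal lt_i; pose b := - u / (h`_d *+ d).
pose R (c : 'rV[F]_m) := closed_roots (map_poly iota (monic_rV c)).
have RE (c : 'rV[F]_m) : map_poly iota (monic_rV c) = \prod_(x <- R c) ('X - x%:P).
  by apply: closed_rootsE; rewrite map_monic monic_rV_monic.
have sR (c : 'rV[F]_m) : size (R c) = m.
  apply: size_closed_roots; first by rewrite map_monic monic_rV_monic.
  by rewrite size_map_poly size_monic_rV.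
have coefR (c : 'rV[F]_m) n : (n <= m)%N -> (revroots (R c))`_n = iota (monic_rV c)`_(m - n).
  by move=> le_nm; rewrite coef_revroots sR // -RE coef_map.
have shift (c : 'rV[F]_m) n : (monic_rV (c + b *: delta_mx 0 i))`_n =
    (monic_rV c)`_n + b *+ (n == m - d)%N.
  rewrite /monic_rV linearD linearZ /= rVpoly_delta addrA coefD coefZ coefXn /=.
  by rewrite mulr_natr.
have key (c : 'rV[F]_m) : root_sum (R (c + b *: delta_mx 0 i)) = root_sum (R c) + iota u.
  set c' := c + _; rewrite !root_sum_psum !big_ord_recr /=.
  have lo n : (n < d)%N -> (revroots (R c'))`_n = (revroots (R c))`_n.
    move=> lt_nd; rewrite !coefR ?shift; try lia.
    have -> : (m - n == m - d)%N = false by lia.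
    by rewrite mulr0n addr0.
  have -> : \sum_(j < d) hK`_j * psum (R c') j = \sum_(j < d) hK`_j * psum (R c) j.
    apply: eq_bigr => j _; congr (_ * _); have := ltn_ord j.
    (* Order 0 is not covered by the comparison of power sums; there both are the number [m] of
       roots. *)
    case: (val j) => [|n] lt_nd; last by apply: (psum_revroots_eq lo).
    by rewrite /psum !big_const_seq !iter_addr_0 !count_predT !sR.
  rewrite -addrA; congr (_ + _); rewrite -[psum (R c') d](subrK (psum (R c) d)).
  rewrite (psum_revroots_diff d0 lo) !coefR // shift eqxx mulr1n.
  rewrite mulrDr addrC; congr (_ + _).
  rewrite rmorphD opprD addNKr coef_map -rmorphN -rmorphMn -rmorphM /=; congr (iota _).
  by rewrite /b -mulr_natr -[in RHS](opprK u); field; rewrite dF hd0.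
(* The shift permutes the row vectors and multiplies each term by the same character value, which is
   not 1. *)
have : Lcoef m = Lcoef m * Psi (ptrace p e (iota u)).
  rewrite {1}/Lcoef (reindex_inj (addIr (b *: delta_mx 0 i))) mulr_suml.
  apply: eq_bigr => c _; rewrite (root_charE (RE _)) (root_charE (RE c)) key (ptraceD pK).
  by rewrite [LHS](prime_charD zeta_p pK) // ptrace_fix ?(root_sum_fixed (RE c)) ?phi_iota.
have E := prime_char_eq1 zeta_p pK (ptrace_fix (phi_iota u)).
move/eqP; rewrite -[X in X == _]mulr1 -subr_eq0 -mulrBr mulf_eq0 subr_eq0.
case/orP=> [/eqP //|]; rewrite eq_sym [_ == _]E -ptrace_rmorph fmorph_eq0.
by rewrite (negPf Tu).
Qed.

(** The logarithmic derivative of the L-series, coefficient by coefficient. The right side runs over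
    pairs of a monic polynomial and a closed path of [phi] contained in its roots; each polynomial
    of degree [m] occurs in exactly [m] pairs. *)
Lemma Lcoef_rec m :
  Lcoef m *+ m = \sum_(n < m) ext_char_sum n.+1 * Lcoef (m - n.+1).
Proof.
pose R (c : 'rV[F]_m) := closed_roots (map_poly iota (monic_rV c)).
have RE (c : 'rV[F]_m) : map_poly iota (monic_rV c) = \prod_(x <- R c) ('X - x%:P).
  by apply: closed_rootsE; rewrite map_monic monic_rV_monic.
have sR (c : 'rV[F]_m) : size (R c) = m.
  apply: size_closed_roots; first by rewrite map_monic monic_rV_monic.
  by rewrite size_map_poly size_monic_rV.
(* The character value at [x] is [root_char P] for the polynomial [P] of the closed path of [x];
   multiplicativity then turns the product into a sum over the monic multiples of [P]. *)
have term (n : 'I_m) : ext_char_sum n.+1 * Lcoef (m - n.+1) =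
    \sum_c root_char (monic_rV c) *+
      count (fun x => submultiset (traject phi x n.+1) (R c)) (fixed_pts n.+1).
  transitivity (\sum_(x <- fixed_pts n.+1) \sum_(c | submultiset (traject phi x n.+1) (R c))
                  root_char (monic_rV c)).
    rewrite /ext_char_sum mulr_suml big_seq [RHS]big_seq; apply: eq_bigr => x xE.
    have [P PE] := orbit_poly (ltn0Sn n) xE.
    have Pm : P \is monic by rewrite -(map_monic iota) PE monic_prod_XsubC.
    have Ps : size P = n.+2 by rewrite -(size_map_poly iota) PE size_prod_XsubC size_traject.
    have -> : Psi (ptrace p (e * n.+1) hK.[x]) = root_char P.
      rewrite (root_charE PE) (ptrace_muln pK); congr (Psi (ptrace p e _)).
      rewrite /root_sum (big_nth x) size_traject big_mkord; apply: eq_bigr => i _.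
      by rewrite nth_traject // -(iter_frob pK) -/phi iter_phi_hK.
    rewrite /Lcoef mulr_sumr.
    under eq_bigr => c _ do rewrite -root_charM ?monic_rV_monic //.
    rewrite -(sum_monic_dvd _ Pm Ps) //; apply: eq_bigl => c.
    by rewrite -(dvdp_map iota) PE RE dvdp_prod_XsubC_submultiset.
  under eq_bigr => x _ do rewrite big_mkcond.
  rewrite exchange_big; apply: eq_bigr => c _ /=.
  by rewrite -big_mkcond big_const_seq iter_addr_0.
under [RHS]eq_bigr => n _ do rewrite term.
rewrite exchange_big -sumrMnl; apply: eq_bigr => c _ /=.
rewrite sumrMnr; congr (_ *+ _); rewrite -{1}(sR c) -(orbit_count_total phi_inj (perm_phi (RE c))).
rewrite sR; apply: eq_bigr => n _; rewrite -!size_filter; apply: perm_size.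
apply: uniq_perm; rewrite ?filter_uniq ?undup_uniq ?uniq_fixed_pts // => x.
rewrite !mem_filter mem_fixed_pts // mem_undup.
apply/andP/andP=> [[/andP[xE sub] _]|[sub xE]]; split=> //; first by apply/andP.
have /submultisetP/(_ x) := sub; rewrite /= eqxx -has_pred1 has_count.
exact: leq_trans.
Qed.

End LFunction.

(** * Weil's bound *)

Lemma weil_bound (F : finFieldType) p e d (zeta : algC) (h : {poly F}) :
  p.-primitive_root zeta -> p \in [pchar F] -> #|F| = (p ^ e)%N ->
  size h = d.+1 -> (0 < d < p)%N ->
  `|\sum_(x : F) prime_char zeta p (ptrace p e h.[x])| <= d.-1%:R * sqrtC #|F|%:R.
Proof.
move=> zp pF cF h_d d0p; have /andP[d0 dp] := d0p.
have [K [iota _]] := countable_algebraic_closure F.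
have pK : p \in [pchar K] := rmorph_pchar iota pF.
pose q := (p ^ e)%N; pose A := Lcoef iota p e zeta h; pose S := ext_char_sum iota p e zeta h.
have q1 : (1 < q)%N by rewrite /q -cF finNzRing_gt1.
(* The numbers [A n] are listed in reversed order, so that they become the coefficients of
   [revroots ws] for the roots [ws] of [L]. *)
pose L : {poly algC} := 'X^(d.-1) + \poly_(i < d.-1) A (d.-1 - i)%N.
have sL : size L = d by rewrite size_polyDl size_polyXn ?ltnS ?size_poly ?prednK.
have Lm : L \is monic by rewrite monicE lead_coefDl ?lead_coefXn // size_polyXn ltnS size_poly.
pose ws := closed_roots L.
have LE : L = \prod_(w <- ws) ('X - w%:P) by apply: closed_rootsE.
have sws : size ws = d.-1 by apply: size_closed_roots; rewrite // sL prednK.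
have A0 : A 0%N = 1 by apply: Lcoef0.
have AE n : (revroots ws)`_n = A n.
  have [le_n|lt_n] := leqP n d.-1; last first.
    by rewrite coef_revroots_gt ?sws // /A (@Lcoef_ge _ _ _ _ _ d) //; lia.
  rewrite coef_revroots sws // -LE coefD coefXn coef_poly.
  case: n le_n => [|n] le_n; first by rewrite subn0 eqxx ltnn addr0 A0.
  have -> : (d.-1 - n.+1 == d.-1)%N = false by lia.
  have -> : (d.-1 - n.+1 < d.-1)%N by lia.
  by rewrite add0r subKn.
(* Newton's identities for [ws] and [Lcoef_rec] are the same recursion up to the sign of the power
   sums. *)
have SE n : (0 < n)%N -> S n = - psum ws n.
  have [m] := ubnP n; elim: m n => // m IHm [//|n] lt_nm _.
  have := newton_revroots ws n.+1; rewrite AE /A (Lcoef_rec _ _ zp pF cF) -/S -/A.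
  rewrite -big_split big_ord_recr big1 /= => [|i _].
    by rewrite add0r subnn AE A0 !mulr1 => /eqP; rewrite addr_eq0 => /eqP.
  have lti := ltn_ord i; rewrite IHm //; last by lia.
  by rewrite AE mulNr addNr.
(* Stepanov's bound concerns even degrees, hence the squares of the roots. The constant [2 * d * p]
   disappears in [power_sum_bound]. *)
have even_bound n : (0 < n)%N ->
    `|\sum_(w <- [seq w ^+ 2 | w <- ws]) w ^+ n| <= (2 * d * p)%:R * q%:R ^+ n.
  move=> n0; rewrite big_map; under eq_bigr => w _ do rewrite -exprM.
  have -> : \sum_(w <- ws) w ^+ (2 * n) = - S (n + n)%N.
    by rewrite SE ?addn_gt0 ?n0 // opprK mul2n -addnn.
  rewrite normrN /S /ext_char_sum.
  have e0 : (0 < e)%N by move: q1; rewrite /q; case: (e).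
  have [m mE] : exists m, (e * n = m.+1)%N by exists (e * n).-1; rewrite prednK ?muln_gt0 ?e0.
  have EN : (e * (n + n) = m.+1 + m.+1)%N by rewrite mulnDr mE.
  rewrite EN -natrX -natrM /q -expnM mE.
  have nn0 : (0 < n + n)%N by rewrite addn_gt0 n0.
  apply: (@trace_char_sum_square_bound _ _ _ _ _ d) => //.
  - by rewrite size_map_poly.
  - exact: (uniq_fixed_pts iota pF cF).
  - by rewrite (size_fixed_pts _ cF) // -expnM EN.
  - by move=> x xE; rewrite -EN (expr_fixed_pts iota pF cF nn0 xE).
  - by move=> x xE; rewrite -EN (horner_fixed_pts iota h pF cF nn0 xE).
have w_bound w : w \in ws -> `|w| <= sqrtC #|F|%:R.
  move=> ww; have := power_sum_bound (ler0n _ q) even_bound (map_f (fun w => w ^+ 2) ww).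
  rewrite normrX => w2; rewrite -(ler_pXn2r (n := 2)) ?nnegrE ?sqrtC_ge0 ?ler0n //.
  by rewrite sqrtCK cF.
rewrite -(ext_char_sum1 iota zeta h pF cF) -/S SE // normrN.
apply: le_trans (ler_norm_sum _ _ _) _; rewrite big_seq.
apply: le_trans (ler_sum _ (fun w ww => w_bound _ (etrans _ ww))) _ => [w ww|].
  by rewrite expr1.
rewrite -big_seq big_const_seq count_predT sws iter_addr_0 mulr_natl //.
Qed.

(** * Eigenvalues of Cayley graphs on F^k *)

Lemma char_poly_simmx (C : fieldType) n (A B P : 'M[C]_n) :
  P \in unitmx -> P *m A = B *m P -> char_poly A = char_poly B.
Proof.
move=> Pu PA; pose Q := map_mx polyC P.
have QA : Q *m char_poly_mx A = char_poly_mx B *m Q.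
  rewrite /char_poly_mx mulmxBr mulmxBl -!map_mxM PA; congr (_ - _).
  by rewrite scalar_mxC.
have Q0 : \det Q != 0 by rewrite det_map_mx polyC_eq0 -unitfE -unitmxE.
apply: (mulfI Q0); rewrite /char_poly -det_mulmx QA det_mulmx mulrC //.
Qed.

(** The functions [u w] are the rows of a matrix whose inverse, by orthogonality, is its conjugate
    transpose divided by [N]. It conjugates the adjacency matrix to the diagonal matrix of the
    [lam w]. *)
Lemma perm_eigs_adjmx (T : finType) (e : rel T) (u : T -> T -> algC) (lam : T -> algC) N :
  N != 0 ->
  (forall w b, \sum_(a | e a b) u w a = lam w * u w b) ->
  (forall w w', \sum_a u w a * (u w' a)^* = N *+ (w == w')) ->
  perm_eq (eigs (adjmx e)) [seq lam w | w : T].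
Proof.
move=> N0 ueig uorth.
pose P : 'M[algC]_#|T| := \matrix_(i, j) u (enum_val i) (enum_val j).
pose D : 'rV[algC]_#|T| := \row_i lam (enum_val i).
have reid (G : T -> algC) : \sum_(i < #|T|) G (enum_val i) = \sum_a G a.
  by rewrite (big_enum_val (A := T)).
have PA : P *m adjmx e = diag_mx D *m P.
  apply/matrixP=> i j; rewrite mul_diag_mx !mxE -ueig [RHS]big_mkcond.
  rewrite -(reid (fun a => if e a (enum_val j) then u (enum_val i) a else 0)).
  by apply: eq_bigr => l _; rewrite !mxE; case: (e _ _); rewrite ?mulr1 ?mulr0.
have Pu : P \in unitmx.
  have PP : P *m (\matrix_(i, j) ((u (enum_val j) (enum_val i))^* / N)) = 1%:M.
    apply/matrixP=> i j; rewrite !mxE.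
    under eq_bigr => k _ do rewrite !mxE mulrA.
    rewrite -mulr_suml (reid (fun a => u (enum_val i) a * (u (enum_val j) a)^*)) uorth.
    by rewrite (inj_eq enum_val_inj) mulrnAl divff.
  by case/mulmx1_unit: PP.
rewrite /eigs; case: closed_field_poly_normal => s /=.
rewrite (monicP (char_poly_monic _)) scale1r (char_poly_simmx Pu PA).
rewrite char_poly_trig ?diag_mx_is_trig // => E.
have : \prod_(x <- s) ('X - x%:P) = \prod_(x <- [seq lam w | w : T]) ('X - x%:P).
  rewrite -E /image_mem big_map big_enum /= [RHS]big_enum_val.
  by apply: eq_bigr => i _; rewrite !mxE eqxx.
exact: prod_XsubC_eq.
Qed.

(** If the entry at index 1 exceeded [B] in absolute value, it would equal [x], and so would the
    entry before it, which is no smaller. Then [x] would occur in [r] as well, against the bound on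
    [r]. *)
Lemma norm_second_largest (s r : seq algC) x B :
  perm_eq s (x :: r) -> 0 <= x -> 0 <= B -> {in r, forall y, y \is Num.real} ->
  {in r, forall y, `|y| <= B} -> `|nth 0 (sort (fun x y : algC => y <= x) s) 1| <= B.
Proof.
move=> s_xr x0 B0 rR rB; set ge := fun x y : algC => y <= x; set t := sort ge s.
have t_xr : perm_eq t (x :: r) by rewrite perm_sort.
have tR : {in t, forall y, y \is Num.real}.
  by move=> y; rewrite (perm_mem t_xr) inE => /orP[/eqP->|/rR//]; apply: ger0_real.
(* The order of [algC] is partial; sorting succeeds because real entries are pairwise comparable. *)
have ts : sorted ge t.
  apply: (@sort_sorted_in _ (mem t)).
    by move=> y z /tR yR /tR zR; rewrite /ge orbC; apply: real_leVge.
  by apply/allP=> y ys; change (y \in t); rewrite /t mem_sort.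
have x1 y : y \in t -> ~~ (`|y| <= B) -> y = x.
  by rewrite (perm_mem t_xr) inE => /orP[/eqP//|/rB->].
clearbody t; case: t t_xr tR ts x1 => [|t0 [|t1 t]] t_xr tR ts x1 /=; rewrite ?normr0 //.
apply/idP; apply: contraT => t1B.
have t1x := x1 t1 (mem_behead (s := [:: t0, t1 & t]) (mem_head _ _)) t1B.
have t0B : ~~ (`|t0| <= B).
  have /= /andP[] := ts; rewrite /ge t1x => t0x _.
  apply: contra t1B; rewrite t1x !ger0_norm //; first exact: le_trans.
  exact: le_trans t0x.
have t0x := x1 t0 (mem_head _ _) t0B.
move: t_xr; rewrite t0x perm_cons t1x => /perm_mem/(_ x); rewrite mem_head => /esym/rB.
by rewrite -t1x (negPf t1B).
Qed.

(** * Additive characters of F^k *)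

Section Characters.
Variables (F : finFieldType) (p e k : nat) (zeta : algC).
Hypotheses (zeta_p : p.-primitive_root zeta) (pF : p \in [pchar F]).
Hypothesis cardF : #|F| = (p ^ e)%N.

Local Notation V := {ffun 'I_k -> F}.

Definition tr_char (y : F) : algC := prime_char zeta p (ptrace p e y).
Definition vchar (w a : V) : algC := tr_char (\sum_i w i * a i).

Let ptrace_fix (y : F) : ptrace p e y ^+ p = ptrace p e y.
Proof. by apply: (ptrace_fixed pF); rewrite -cardF expf_card. Qed.

Lemma tr_charD x y : tr_char (x + y) = tr_char x * tr_char y.
Proof. by rewrite /tr_char (ptraceD pF) (prime_charD zeta_p pF). Qed.

Lemma tr_char0 : tr_char 0 = 1.
Proof. by rewrite /tr_char (ptrace0 pF) (prime_char0 zeta_p pF). Qed.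

Lemma tr_char_eq1 x : (tr_char x == 1) = (ptrace p e x == 0).
Proof. by rewrite /tr_char (prime_char_eq1 zeta_p pF). Qed.

Lemma norm_tr_char x : `|tr_char x| = 1.
Proof. by rewrite /tr_char (norm_prime_char zeta_p pF). Qed.

Lemma conj_tr_char x : (tr_char x)^* = tr_char (- x).
Proof.
have x0 : tr_char x != 0 by rewrite -normr_eq0 norm_tr_char oner_eq0.
apply: (mulfI x0); rewrite -tr_charD subrr tr_char0 -normCK norm_tr_char.
by rewrite expr1n.
Qed.

Lemma vcharC w a : vchar w a = vchar a w.
Proof. by congr tr_char; apply: eq_bigr => i _; rewrite mulrC. Qed.

Lemma vcharD w a b : vchar w (a + b) = vchar w a * vchar w b.
Proof.
rewrite /vchar -tr_charD -big_split; congr tr_char.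
by apply: eq_bigr => i _; rewrite ffunE mulrDr.
Qed.

Lemma conj_vchar w a : (vchar w a)^* = vchar w (- a).
Proof.
rewrite /vchar conj_tr_char -sumrN; congr tr_char.
by apply: eq_bigr => i _; rewrite ffunE mulrN.
Qed.

Lemma vchar0 w : vchar w 0 = 1.
Proof. by rewrite /vchar big1 ?tr_char0 // => i _; rewrite ffunE mulr0. Qed.

Lemma vchar_nontrivial w : w != 0 -> exists b, vchar w b != 1.
Proof.
move=> w0; have [i wi] : exists i, w i != 0.
  apply/existsP; apply: contraNT w0; rewrite negb_exists => /forallP H.
  by apply/eqP/ffunP=> i; rewrite ffunE; apply/eqP/negbNE/H.
have [u] : exists u, ptrace p e ('X : {poly F}).[u] != 0.
  by apply: exists_ptrace_neq0; rewrite // size_polyX (prime_gt1 (pcharf_prime pF)).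
rewrite hornerX => Tu.
exists [ffun j => if j == i then u / w i else 0].
rewrite /vchar (bigD1 i) //= big1 => [|j /negPf ji]; last by rewrite ffunE ji mulr0.
by rewrite ffunE eqxx addr0 mulrC divfK // tr_char_eq1.
Qed.

(** For [w != 0], translation by some [b] with [vchar w b != 1] multiplies the sum by that value, so
    the sum vanishes. *)
Lemma sum_vchar w : \sum_a vchar w a = #|V|%:R *+ (w == 0).
Proof.
have [->|/vchar_nontrivial[b wb]] := eqVneq w 0.
  under eq_bigr => a _ do rewrite vcharC vchar0.
  by rewrite sumr_const mulr1n.
have /eqP : \sum_a vchar w a = (\sum_a vchar w a) * vchar w b.
  rewrite {1}(reindex_inj (addIr b)) mulr_suml.
  by apply: eq_bigr => a _; rewrite vcharD.
rewrite -[X in X == _]mulr1 -subr_eq0 -mulrBr mulf_eq0 subr_eq0 eq_sym.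
by rewrite [1 == _]eq_sym (negPf wb) orbF eq_sym => /eqP.
Qed.

Lemma vchar_orthogonal w w' :
  \sum_a vchar w a * (vchar w' a)^* = #|V|%:R *+ (w == w').
Proof.
rewrite -subr_eq0 -sum_vchar; apply: eq_bigr => a _.
by rewrite [RHS]vcharC vcharD -conj_vchar !(vcharC a).
Qed.

Section Cayley.
Variables (adj : rel V) (S : pred V).
Hypotheses (adjE : forall a b, adj a b = S (b - a)) (S_opp : forall s, S (- s) = S s).

Definition cayley_eig w : algC := \sum_(s | S s) vchar w s.

Lemma cayley_eigE w b : \sum_(a | adj a b) vchar w a = cayley_eig w * vchar w b.
Proof.
rewrite (reindex_inj (addrI b)) mulr_suml; apply: eq_big => [s|s _].
  by rewrite adjE opprD addNKr S_opp.
by rewrite vcharD mulrC.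
Qed.

Lemma cayley_eig_real w : cayley_eig w \is Num.real.
Proof.
rewrite CrealE; apply/eqP; rewrite /cayley_eig rmorph_sum /= [RHS](reindex_inj (@oppr_inj V)).
by apply: eq_big => s; rewrite ?S_opp // => _; rewrite conj_vchar.
Qed.

Lemma perm_eigs_cayley : perm_eq (eigs (adjmx adj)) [seq cayley_eig w | w : V].
Proof.
apply: (perm_eigs_adjmx _ cayley_eigE vchar_orthogonal).
by rewrite pnatr_eq0 -lt0n; apply/card_gt0P; exists 0.
Qed.

(* The indicator of a connected component is invariant under translation by
   [S], so its Fourier coefficients at [w != 0] vanish: it is constant. *)
Lemma cayley_connected :
  (forall w, w != 0 -> exists2 s, S s & vchar w s != 1) -> connected_graph adj.
Proof.
move=> H x y; pose c a : algC := (connect adj x a)%:R.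
have adj_sym a b : adj a b = adj b a by rewrite !adjE -S_opp opprB.
have c_shift s a : S s -> c (a + s) = c a.
  move=> Ss; have as_adj : adj a (a + s) by rewrite adjE addrC addKr.
  congr (_%:R); apply: (congr1 nat_of_bool); apply/idP/idP => /connect_trans; apply.
    by apply: connect1; rewrite adj_sym.
  exact: connect1.
pose fc w := \sum_a c a * vchar w a.
have fc0 w : w != 0 -> fc w = 0.
  move=> /H[s Ss ws]; have /eqP : fc w = fc w * vchar w s.
    rewrite {1}/fc (reindex_inj (addIr s)) mulr_suml.
    by apply: eq_bigr => a _; rewrite c_shift // vcharD mulrA.
  rewrite -[X in X == _]mulr1 -subr_eq0 -mulrBr mulf_eq0 subr_eq0.
  by rewrite [1 == _]eq_sym (negPf ws) orbF => /eqP.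
(* Fourier inversion, in which only the coefficient at 0 remains. *)
have inv b : #|V|%:R * c b = fc 0.
  transitivity (\sum_w fc w * (vchar w b)^*); last first.
    rewrite (bigD1 (0 : V)) //= big1 ?addr0 => [|w w0]; last by rewrite fc0 ?mul0r.
    by rewrite vcharC vchar0 conjC1 mulr1.
  under eq_bigr => w _ do rewrite mulr_suml.
  rewrite exchange_big (bigD1 b) //= [X in _ + X]big1 ?addr0 => [|a ab].
    under eq_bigr => w _ do rewrite -mulrA ![vchar w _]vcharC.
    by rewrite -mulr_sumr vchar_orthogonal eqxx mulrC.
  under eq_bigr => w _ do rewrite -mulrA ![vchar w _]vcharC.
  by rewrite -mulr_sumr vchar_orthogonal (negPf ab) mulr0n mulr0.
have V0 : #|V|%:R != 0 :> algC.
  by rewrite pnatr_eq0 -lt0n; apply/card_gt0P; exists 0.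
have /(mulfI V0) : #|V|%:R * c y = #|V|%:R * c x by rewrite !inv.
rewrite /c connect0; case: (connect adj x y) => // /eqP.
by rewrite eq_sym oner_eq0.
Qed.

End Cayley.
End Characters.

(** * The graph S(k, q) *)

Lemma size_maxdeg (F : fieldType) k (f : 'I_k -> {poly F}) (i : 'I_k) :
  (2 <= i)%N -> (size (f i) <= (maxdeg f).+1)%N.
Proof.
move=> i2; apply: leq_trans (leqSpred _) _; rewrite ltnS.
exact: (leq_bigmax_cond (F := fun i => pdeg (f i))).
Qed.

Section SGraph.
Variables (F : finFieldType) (p e k : nat) (hk : (2 < k)%N) (f g : 'I_k -> {poly F}).
Variable zeta : algC.
Hypotheses (zeta_p : p.-primitive_root zeta) (pF : p \in [pchar F]).
Hypothesis cardF : #|F| = (p ^ e)%N.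
Hypothesis f_size : forall i : 'I_k, (2 <= i)%N -> (size (f i) <= #|F|)%N.
Hypothesis g_odd : forall i : 'I_k, (2 <= i)%N -> g i \Po (- 'X) = - g i.
Hypothesis g_0 : forall i : 'I_k, (2 <= i)%N -> (g i).[0] = 0.
Hypotheses (df_ge1 : (1 <= maxdeg f)%N) (dg_ge1 : (1 <= maxdeg g)%N).
Hypothesis dg_lt_p : (maxdeg g < p)%N.
Hypothesis fg_cond :
  (lin_indep_on predT (one_X_f f) /\ (forall i : 'I_k, (2 <= i)%N -> (g i)`_1 != 0))
  \/
  (lin_indep_on (fun i : 'I_k => (2 <= i)%N) f /\
   exists j : nat, [/\ (2 <= j)%N, (j <= maxdeg g)%N &
     forall i : 'I_k, (2 <= i)%N -> (g i)`_j != 0]).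

Local Notation V := {ffun 'I_k -> F}.
Local Notation tr := (tr_char p e zeta).
Local Notation i0 := (i0 hk).
Local Notation i1 := (i1 hk).

Definition connection_set (s : V) : bool :=
  (s i0 != 0) && [forall i : 'I_k, (2 <= i)%N ==>
                   (s i == (g i).[s i0] * (f i).[s i1 / s i0])].

Lemma Sadj_connection a b : Sadj hk f g a b = connection_set (b - a).
Proof.
rewrite /Sadj /connection_set !ffunE subr_eq0 eq_sym; congr (_ && _).
by apply: eq_forallb => i; rewrite !ffunE.
Qed.

Lemma connection_setN s : connection_set (- s) = connection_set s.
Proof.
rewrite /connection_set !ffunE oppr_eq0; congr (_ && _); apply: eq_forallb => i.
case: (leqP 2 i) => //= i2; rewrite !ffunE invrN mulrNN.
have -> : (g i).[- s i0] = - (g i).[s i0].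
  by rewrite -hornerN -g_odd // horner_comp hornerN hornerX.
by rewrite mulNr eqr_opp.
Qed.

(** For [u != 0] these points parametrize the connection set: [u] is the first coordinate and [t]
    the quotient of the second by the first. *)
Definition Spoint (u t : F) : V :=
  [ffun i => if i == i0 then u else if i == i1 then u * t else (g i).[u] * (f i).[t]].

Lemma not_i01 (i : 'I_k) : (i != i0) && (i != i1) = (2 <= i)%N.
Proof. by rewrite -!val_eqE /=; case: (val i) => [|[|]]. Qed.

Lemma ge2_i0 (i : 'I_k) : (2 <= i)%N -> (i == i0) = false.
Proof. by rewrite -not_i01 => /andP[/negPf]. Qed.

Lemma ge2_i1 (i : 'I_k) : (2 <= i)%N -> (i == i1) = false.
Proof. by rewrite -not_i01 => /andP[_ /negPf]. Qed.

Lemma Spoint0 u t : Spoint u t i0 = u. Proof. by rewrite ffunE eqxx. Qed.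
Lemma Spoint1 u t : Spoint u t i1 = u * t. Proof. by rewrite ffunE eqxx. Qed.

Lemma connection_set_point u t : connection_set (Spoint u t) = (u != 0).
Proof.
rewrite /connection_set Spoint0 Spoint1; case: eqP => //= /eqP u0.
apply/forallP=> i; apply/implyP=> i2; rewrite ffunE ge2_i0 ?ge2_i1 //.
by rewrite mulrAC divff ?mul1r.
Qed.

(** The polynomial [h_{w,t}] of the introduction: the pairing of [w] with [Spoint u t] as a
    polynomial in [u]. *)
Definition fiber_poly (w : V) (t : F) : {poly F} :=
  (w i0 + w i1 * t) *: 'X + \sum_(i < k | (2 <= i)%N) (w i * (f i).[t]) *: g i.

Lemma big_i01 (G : 'I_k -> F) :
  \sum_i G i = G i0 + (G i1 + \sum_(i < k | (2 <= i)%N) G i).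
Proof.
rewrite (bigD1 i0) // (bigD1 i1) //=; congr (_ + (_ + _)).
by apply: eq_bigl => i; rewrite not_i01.
Qed.

Lemma vchar_point w u t :
  vchar p e zeta w (Spoint u t) = tr (fiber_poly w t).[u].
Proof.
rewrite /vchar; congr tr_char; rewrite big_i01 Spoint0 Spoint1 /fiber_poly.
rewrite hornerD hornerZ hornerX horner_sum addrA; congr (_ + _); first by ring.
apply: eq_bigr => i i2; rewrite ffunE ge2_i0 ?ge2_i1 // hornerZ; ring.
Qed.

Lemma fiber_poly_at0 w t : (fiber_poly w t).[0] = 0.
Proof.
rewrite hornerD hornerZ hornerX mulr0 add0r horner_sum big1 // => i i2.
by rewrite hornerZ g_0 ?mulr0.
Qed.

(** The subtracted 1 is the term [u = 0], which lies outside the connection set and where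
    [fiber_poly] vanishes. *)
Lemma eig_fiber w : cayley_eig p e zeta connection_set w =
  \sum_t (\sum_u tr (fiber_poly w t).[u] - 1).
Proof.
transitivity (\sum_t \sum_(u | u != 0) tr (fiber_poly w t).[u]); last first.
  apply: eq_bigr => t _; rewrite [in RHS](bigD1 0) //= fiber_poly_at0.
  by rewrite (tr_char0 e zeta_p pF) [RHS]addrAC subrr add0r.
rewrite (exchange_big_dep (fun u => u != 0)) //= pair_big_dep /=.
rewrite /cayley_eig (reindex_onto (fun ut : F * F => Spoint ut.1 ut.2)
  (fun s : V => (s i0, s i1 / s i0))) /=; last first.
  move=> s /andP[s0 /forallP sS]; apply/ffunP=> i; rewrite ffunE.
  case: eqP => [->//|/eqP ne0]; case: eqP => [->|/eqP ne1]; first by rewrite mulrC divfK.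
  have i2 : (2 <= i)%N by rewrite -not_i01 ne0.
  by have := sS i; rewrite i2 => /eqP->.
apply: eq_big => [[u t]|[u t] _] /=; last exact: vchar_point.
rewrite connection_set_point Spoint0 Spoint1 andbb; case: eqP => //= /eqP u0.
by rewrite mulrAC divff ?mul1r ?eqxx.
Qed.

Lemma size_fiber_poly w t : fiber_poly w t != 0 ->
  (1 < size (fiber_poly w t) <= (maxdeg g).+1)%N.
Proof.
move=> nz; apply/andP; split.
  rewrite ltnNge; apply: contra nz => /size1_polyC E.
  by have := fiber_poly_at0 w t; rewrite E hornerC => ->.
apply: leq_trans (size_polyD _ _) _; rewrite geq_max; apply/andP; split.
  by apply: leq_trans (size_scale_leq _ _) _; rewrite size_polyX.
apply: leq_trans (size_sum _ _ _) _; apply/bigmax_leqP=> i i2.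
by apply: leq_trans (size_scale_leq _ _) _; apply: size_maxdeg.
Qed.

(* [R] is a suitable coefficient of [fiber_poly w t], read as a polynomial in [t]. *)
Lemma fiber_poly_root w : w != 0 ->
  exists R : {poly F}, [/\ R != 0, (size R <= (maxdeg f).+1)%N &
    forall t, fiber_poly w t = 0 -> R.[t] = 0].
Proof.
move=> w0.
have coef_fiber t j : (fiber_poly w t)`_j =
    (w i0 + w i1 * t) * (j == 1)%:R + \sum_(i < k | (2 <= i)%N) w i * (f i).[t] * (g i)`_j.
  rewrite coefD coefZ coefX coef_sum; congr (_ + _).
  by apply: eq_bigr => i _; rewrite coefZ.
have size_comb (c : 'I_k -> F) :
    (size (\sum_(i < k | (2 <= i)%N) c i *: f i)%R <= (maxdeg f).+1)%N.
  apply: leq_trans (size_sum _ _ _) _; apply/bigmax_leqP=> i i2.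
  by apply: leq_trans (size_scale_leq _ _) _; apply: size_maxdeg.
have size_lin (a b : F) : (size (a%:P + b *: 'X)%R <= (maxdeg f).+1)%N.
  apply: leq_trans (size_polyD _ _) _; rewrite geq_max (leq_trans (size_polyC_leq1 _)) //=.
  by apply: leq_trans (size_scale_leq _ _) _; rewrite size_polyX.
case: fg_cond => [[indep g1]|[indep [j [j2 _ gj]]]].
  (* Under the first condition the coefficient of [X] serves; [c] gives its coordinates with respect
     to [1, X] and the [f i]. *)
  pose c (i : 'I_k) := if (2 <= i)%N then w i * (g i)`_1 else w i.
  pose R : {poly F} := (w i0)%:P + w i1 *: 'X +
    \sum_(i < k | (2 <= i)%N) (w i * (g i)`_1) *: f i.
  exists R; split.
  - apply: contra w0 => /eqP R0; apply/eqP/ffunP=> i; rewrite [RHS]ffunE.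
    have : \sum_(i < k) c i *: one_X_f f i = 0.
      apply: etrans R0; rewrite /R (bigD1 i0) // (bigD1 i1) //= addrA /c /one_X_f /= alg_polyC.
      congr (_ + _); apply: eq_big => [l|l]; first by rewrite not_i01.
      rewrite not_i01 => l2; rewrite l2.
      by move: l2; case: (val l) => [|[|]].
    move/indep/(_ i isT); rewrite /c; case: ifP => // i2 /eqP.
    by rewrite mulf_eq0 (negPf (g1 i i2)) orbF => /eqP.
  - apply: leq_trans (size_polyD _ _) _; rewrite geq_max size_lin.
    exact: (size_comb (fun i => w i * (g i)`_1)).
  - move=> t /polyP/(_ 1%N); rewrite coef_fiber coef0 mulr1 => <-.
    rewrite !hornerE horner_sum; congr (_ + _).
    by apply: eq_bigr => i _; rewrite hornerZ mulrAC.
(* Under the second condition, if all [w i] with [i >= 2] vanish, only the linear term is left.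
   Otherwise the coefficient of [X^j] serves, to which the linear term does not contribute as
   [j >= 2]. *)
have [w2|w2] := boolP [forall i : 'I_k, (2 <= i)%N ==> (w i == 0)].
  have wi (i : 'I_k) : (2 <= i)%N -> w i = 0.
    by move=> i2; have /forallP/(_ i) := w2; rewrite i2 => /eqP.
  exists ((w i0)%:P + w i1 *: 'X); split=> //.
  - apply: contra w0 => /eqP R0; apply/eqP/ffunP=> i; rewrite [RHS]ffunE.
    have /polyP R0' := R0.
    have := R0' 0%N; have := R0' 1%N; rewrite !coefD !coefC !coefZ !coefX /= ?coef0.
    rewrite mulr0 mulr1 add0r addr0 => w1E w0E.
    have [->//|ne0] := eqVneq i i0; have [->//|ne1] := eqVneq i i1.
    by apply: wi; rewrite -not_i01 ne0.
  - move=> t /polyP/(_ 1%N); rewrite coef_fiber coef0 mulr1 => <-.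
    rewrite !hornerE big1 ?addr0 // => i i2.
    by rewrite wi // !mul0r.
exists (\sum_(i < k | (2 <= i)%N) (w i * (g i)`_j) *: f i); split.
- apply: contra w2 => /eqP /indep H; apply/forallP=> i; apply/implyP=> i2.
  by have /eqP := H i i2; rewrite mulf_eq0 (negPf (gj i i2)) orbF.
- exact: (size_comb (fun i => w i * (g i)`_j)).
- move=> t /polyP/(_ j); rewrite coef_fiber coef0.
  have -> : (j == 1)%N = false by case: (j) j2 => [|[|]].
  rewrite mulr0 add0r => E; apply: etrans E; rewrite horner_sum.
  by apply: eq_bigr => i _; rewrite hornerZ mulrAC.
Qed.

Lemma card_fiber_poly_eq0 w : w != 0 ->
  (#|[pred t | (fiber_poly w t == 0)%R]| <= maxdeg f)%N.
Proof.
move=> /fiber_poly_root[R [R0 sR RP]]; rewrite -ltnS; apply: leq_trans sR.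
rewrite cardE; apply: max_poly_roots; rewrite ?enum_uniq //.
by apply/allP=> t; rewrite mem_enum inE => /eqP/RP/eqP.
Qed.

Lemma maxdeg_lt_card : (maxdeg f < #|F|)%N.
Proof.
have F0 : (0 < #|F|)%N by apply/card_gt0P; exists 0.
rewrite -(prednK F0) ltnS; apply/bigmax_leqP=> i i2; rewrite /pdeg.
by rewrite -!subn1 leq_sub2r ?f_size.
Qed.

Lemma Sgraph_connected : connected_graph (Sadj hk f g).
Proof.
apply: (cayley_connected zeta_p pF cardF Sadj_connection connection_setN) => w w0.
(* Otherwise [fiber_poly w t] would vanish for all [#|F|] values of [t], more than the [maxdeg f]
   allowed. *)
have [t ht] : exists t, fiber_poly w t != 0.
  apply/existsP; apply: negbNE; rewrite negb_exists; apply/negP=> /forallP H.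
  have := card_fiber_poly_eq0 w0; rewrite (eq_card (B := F)) => [|t].
    by rewrite leqNgt maxdeg_lt_card.
  by rewrite !inE; have := H t; rewrite negbK => ->.
have /andP[h1 hs] := size_fiber_poly ht.
have [u Tu] : exists u, ptrace p e (fiber_poly w t).[u] != 0.
  by apply: exists_ptrace_neq0; rewrite // h1 (leq_trans hs).
exists (Spoint u t); last by rewrite vchar_point (tr_char_eq1 zeta_p pF cardF).
rewrite connection_set_point; apply: contraNneq Tu => ->.
by rewrite fiber_poly_at0 (ptrace0 pF).
Qed.


Lemma norm_tr_sum w t : 
  fiber_poly w t != 0 ->
  `|\sum_u tr (fiber_poly w t).[u]| <= (maxdeg g)%:R * sqrtC #|F|%:R.
Proof.
move=> nz.
have /andP[h1 hs] := size_fiber_poly nz.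
have hE : size (fiber_poly w t) = (size (fiber_poly w t)).-1.+1 by rewrite prednK // ltnW.
have d0p : (0 < (size (fiber_poly w t)).-1 < p)%N.
  by move: h1 hs dg_lt_p; clear; move: (size _) (maxdeg g) => [|n] m; lia.
apply: le_trans (weil_bound zeta_p pF cardF hE d0p) _.
rewrite ler_wpM2r ?sqrtC_ge0 ?ler0n // ler_nat.
by move: h1 hs; clear; move: (size _) (maxdeg g) => [|n] m; lia.
Qed.

Lemma eig_bound w : w != 0 -> `|cayley_eig p e zeta connection_set w| <=
  #|F|%:R + (maxdeg f)%:R * #|F|%:R + #|F|%:R * ((maxdeg g)%:R * sqrtC #|F|%:R).
Proof.
move=> w0; rewrite eig_fiber; apply: le_trans (ler_norm_sum _ _ _) _.
pose B : algC := (maxdeg g)%:R * sqrtC #|F|%:R.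
have B0 : 0 <= B by rewrite mulr_ge0 ?sqrtC_ge0 ?ler0n.
(* Where the fiber polynomial vanishes the inner sum is trivially at most [#|F|]; elsewhere Weil's
   bound gives [B]. *)
have nbound t : `|\sum_u tr (fiber_poly w t).[u] - 1| <=
    1 + (if fiber_poly w t == 0 then #|F|%:R else 0) + B.
  apply: le_trans (ler_normB _ _) _; rewrite normr1 addrC -addrA lerD2l.
  case: eqP => [->|/eqP nz]; last by rewrite add0r norm_tr_sum.
  apply: (@le_trans _ _ #|F|%:R); last by rewrite lerDl.
  apply: le_trans (ler_norm_sum _ _ _) _.
  under eq_bigr => u _ do rewrite horner0 (tr_char0 e zeta_p pF) normr1.
  by rewrite sumr_const.
apply: le_trans (ler_sum _ (fun t _ => nbound t)) _.
have -> : \sum_t (1 + (if fiber_poly w t == 0 then #|F|%:R else 0) + B) =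
    #|F|%:R + #|[pred t | (fiber_poly w t == 0)%R]|%:R * #|F|%:R + #|F|%:R * B.
  rewrite !big_split -big_mkcond; congr (_ + _ + _).
  - by rewrite sumr_const.
  - by rewrite sumr_const mulr_natl.
  - by rewrite sumr_const mulr_natl.
rewrite lerD2r lerD2l ler_wpM2r ?ler0n // ler_nat.
exact: card_fiber_poly_eq0.
Qed.

Lemma lambda2_Sgraph : `|lambda2 (adjmx (Sadj hk f g))| <=
  #|F|%:R + (maxdeg f)%:R * #|F|%:R + #|F|%:R * ((maxdeg g)%:R * sqrtC #|F|%:R).
Proof.
have := perm_eigs_cayley zeta_p pF cardF Sadj_connection connection_setN.
(* The trivial character is set aside: its eigenvalue is the size of the connection set, and all
   others obey [eig_bound]. *)
pose z : V := 0.
have enumE : perm_eq (enum V) (z :: [seq w <- enum V | w != z]).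
  apply: uniq_perm; rewrite ?enum_uniq //=.
    by rewrite mem_filter eqxx filter_uniq ?enum_uniq.
  move=> w; rewrite in_cons mem_enum (mem_filter _ _ (enum V)) mem_enum !inE andbT.
  by case: eqP.
rewrite /image_mem => eigsE.
have {eigsE}eigsE := perm_trans eigsE (perm_map _ enumE).
apply: (norm_second_largest eigsE).
- by apply: sumr_ge0 => s _; rewrite vcharC (vchar0 e zeta_p pF) ler01.
- by rewrite !addr_ge0 ?mulr_ge0 ?ler0n ?sqrtC_ge0 ?ler0n.
- by move=> y /mapP[w _ ->]; apply: (cayley_eig_real zeta_p pF cardF connection_setN).
- by move=> y /mapP[w]; rewrite mem_filter => /andP[w0 _] ->; apply: eig_bound.
Qed.
End SGraph.

(** * Connectedness and the asymptotic estimate *)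

Theorem theorem2
  (k : nat) (hk : (2 < k)%N)
  (q p e : nat -> nat)
  (q_incr : forall m, (q m < q m.+1)%N)
  (p_prime : forall m, prime (p m))
  (q_pow : forall m, q m = (p m ^ e m)%N)
  (F : nat -> finFieldType)
  (F_card : forall m, #|F m| = q m)
  (f g : forall m : nat, 'I_k -> {poly F m})
  (f_size : forall m (i : 'I_k), (2 <= i)%N -> (size (f m i) <= q m)%N)
  (g_size : forall m (i : 'I_k), (2 <= i)%N -> (size (g m i) <= q m)%N)
  (g_odd : forall m (i : 'I_k), (2 <= i)%N -> g m i \Po (- 'X) = - g m i)
  (g_0 : forall m (i : 'I_k), (2 <= i)%N -> (g m i).[0] = 0)
  (df_ge1 : forall m, (1 <= maxdeg (f m))%N)
  (df_o : little_o (fun m => (maxdeg (f m))%:R) (fun m => (q m)%:R))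
  (dg_o : little_o (fun m => (maxdeg (g m))%:R) (fun m => sqrtC (q m)%:R))
  (dg_ge1 : forall m, (1 <= maxdeg (g m))%N)
  (dg_lt_p : forall m, (maxdeg (g m) < p m)%N)
  (cond : forall m,
     (lin_indep_on predT (one_X_f (f m)) /\
      (forall i : 'I_k, (2 <= i)%N -> (g m i)`_1 != 0))
     \/
     (lin_indep_on (fun i : 'I_k => (2 <= i)%N) (f m) /\
      exists j : nat, [/\ (2 <= j)%N, (j <= maxdeg (g m))%N &
        forall i : 'I_k, (2 <= i)%N -> (g m i)`_j != 0])) :
  (forall m, connected_graph (Sadj hk (f m) (g m))) /\
  little_o (fun m => lambda2 (adjmx (Sadj hk (f m) (g m))))
           (fun m => ((q m) ^ 2)%:R).
Proof.
have cF m : #|F m| = (p m ^ e m)%N by rewrite F_card.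
have pF m : p m \in [pchar F m] := card_finPcharP (cF m) (p_prime m).
have sf m (i : 'I_k) : (2 <= i)%N -> (size (f m i) <= #|F m|)%N.
  by rewrite F_card; apply: f_size.
split=> [m|].
  have [zeta zp] := C_prim_root_exists (prime_gt0 (p_prime m)).
  apply: (Sgraph_connected hk zp (pF m) (cF m) (sf m) (g_odd m) (g_0 m)
    (df_ge1 m) (dg_ge1 m) (dg_lt_p m) (cond m)).
(* One third of [eps] for each of the three terms of the eigenvalue bound. *)
move=> eps eps0; pose d := eps / 3%:R.
have d0 : 0 < d by rewrite divr_gt0 // ltr0n.
have [N1 HN1] := df_o d d0; have [N2 HN2] := dg_o d d0.
have q_ge m : (m <= q m)%N.
  by elim: m => // m IHm; apply: leq_ltn_trans IHm (q_incr m).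
(* Since [q m >= m], the first threshold yields [1 <= d * q m], which controls the term [q m] of the
   bound. *)
exists (maxn (Num.bound d^-1) (maxn N1 N2)) => m.
rewrite !geq_max => /and3P[le_b /HN1 le_df /HN2 le_dg].
have [zeta zp] := C_prim_root_exists (prime_gt0 (p_prime m)).
apply: le_trans (lambda2_Sgraph hk zp (pF m) (cF m) (g_odd m) (g_0 m)
    (df_ge1 m) (dg_ge1 m) (dg_lt_p m) (cond m)) _.
rewrite F_card natrX; move: le_df le_dg.
set Q : algC := (q m)%:R; set sQ := sqrtC Q.
have Q0 : 0 <= Q by rewrite ler0n.
have sQ0 : 0 <= sQ by rewrite sqrtC_ge0.
have sQ2 : Q = sQ * sQ by rewrite -expr2 sqrtCK.
rewrite !normr_nat (ger0_norm sQ0) normrX (ger0_norm Q0) => le_df le_dg.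
have le_1 : 1 <= d * Q.
  rewrite mulrC -ler_pdivrMr // div1r; apply: ltW.
  apply: lt_le_trans (archi_boundP _) _; first by rewrite invr_ge0 ltW.
  by rewrite ler_nat (leq_trans le_b).
have -> : eps * Q ^+ 2 = d * Q * Q + d * Q * Q + Q * (d * sQ * sQ).
  have -> : eps = d *+ 3 by rewrite -mulr_natr divfK // pnatr_eq0.
  by rewrite -(mulrA d sQ) -sQ2 expr2; ring.
apply: lerD; first apply: lerD.
- by rewrite -[X in X <= _]mul1r ler_wpM2r.
- by rewrite ler_wpM2r.
- by rewrite ler_wpM2l // ler_wpM2r.
Qed.
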